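(* Consider either the multi-indexed Laguerre case (L) or the multi-indexed Jacobi case (J), with multi-index $\mathcal D$, integer $\mathcal N\ge1$, and the associated $\widetilde{\mathcal N}\times\widetilde{\mathcal N}$ matrix $\mathcal M$ (defined in the context). For each $m=0,1,\dots,\mathcal N-1$, the vector ${\rm v}^{(m)}$ with components $${\rm v}^{(m)}_n=\frac{P_{\mathcal D,m}(\eta_n)}{\dot\eta(x_n)\,P'_{\mathcal D,\mathcal N}(\eta_n)},\qquad n=1,\dots,\widetilde{\mathcal N},$$ is an eigenvector of $\mathcal M$ with eigenvalue $\mathcal E(\mathcal N)-\mathcal E(m)$: $$\sum_{l=1}^{\widetilde{\mathcal N}}\mathcal M_{nl}\,{\rm v}^{(m)}_l=\bigl(\mathcal E(\mathcal N)-\mathcal E(m)\bigr){\rm v}^{(m)}_n,\qquad n=1,\dots,\widetilde{\mathcal N}.$$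
   Context: **Multi-index and parameters.** $\mathcal D=\mathcal D^{\rm I}\cup\mathcal D^{\rm II}$, $\mathcal D^{\rm I}=\{d_1^{\rm I}<\dots<d_M^{\rm I}\}$, $\mathcal D^{\rm II}=\{d_1^{\rm II}<\dots<d_N^{\rm II}\}$, positive integers, $M,N\ge0$, $M+N\ge1$ (the labels I and II are part of the data). Real parameters: $g$ in case L, with $g>\max\{N+\frac32,\,d_j^{\rm II}+\frac12\}$; $(g,h)$ in case J, with $g>\max\{N+2,\,d_j^{\rm II}+\frac12\}$, $h>\max\{M+2,\,d_j^{\rm I}+\frac12\}$. **Polynomials.** $P_n=L_n^{(g-1/2)}$ (Laguerre, L), $P_n=P_n^{(g-1/2,h-1/2)}$ (Jacobi, J). For an integer ${\rm v}\ge 0$ put - L: $\mu^{\rm I}_{\rm v}(\eta)=e^{\eta}L^{(g-1/2)}_{\rm v}(-\eta)$, $\ \mu^{\rm II}_{\rm v}(\eta)=\eta^{1/2-g}L^{(1/2-g)}_{\rm v}(\eta)$; - J: $\mu^{\rm I}_{\rm v}(\eta)=\bigl(\frac{1+\eta}2\bigr)^{1/2-h}P^{(g-1/2,1/2-h)}_{\rm v}(\eta)$, $\ \mu^{\rm II}_{\rm v}(\eta)=\bigl(\frac{1-\eta}2\bigr)^{1/2-g}P^{(1/2-g,h-1/2)}_{\rm v}(\eta)$. With ${\rm W}[f_1,\dots,f_r]=\det(d^{i-1}f_j/d\eta^{i-1})_{1\le i,j\le r}$, define the polynomials $$\Xi_{\mathcal D}(\eta)={\rm W}[\mu^{\rm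 I}_{d^{\rm I}_1},\dots,\mu^{\rm I}_{d^{\rm I}_M},\mu^{\rm II}_{d^{\rm II}_1},\dots,\mu^{\rm II}_{d^{\rm II}_N}]\times\begin{cases}\eta^{(M+g-\frac12)N}e^{-M\eta}&\text{L}\\ \bigl(\frac{1-\eta}2\bigr)^{(M+g-\frac12)N}\bigl(\frac{1+\eta}2\bigr)^{(N+h-\frac12)M}&\text{J}\end{cases}$$ $$P_{\mathcal D,n}(\eta)={\rm W}[\mu^{\rm I}_{d^{\rm I}_1},\dots,\mu^{\rm I}_{d^{\rm I}_M},\mu^{\rm II}_{d^{\rm II}_1},\dots,\mu^{\rm II}_{d^{\rm II}_N},P_n]\times\begin{cases}\eta^{(M+g+\frac12)N}e^{-M\eta}&\text{L}\\ \bigl(\frac{1-\eta}2\bigr)^{(M+g+\frac12)N}\bigl(\frac{1+\eta}2\bigr)^{(N+h+\frac12)M}&\text{J}\end{cases}$$ and $\ell_{\mathcal D}=\sum_j d_j^{\rm I}-\frac12M(M-1)+\sum_j d_j^{\rm II}-\frac12N(N-1)+MN$, $\ \widetilde{\mathcal N}=\ell_{\mathcal D}+\mathcal N$. **Differential operator.** $\mathcal E(n)=4n$ (L), $\mathcal E(n)=4n(n+g+h)$ (J). $c_2(\eta)=\eta$ (L), $1-\eta^2$ (J). Put $c_1(\eta;g)=g+\frac12-\eta$ (L), $c_1(\eta;g,h)=h-g-(g+h+1)\eta$ (J). Let $C_1$ be $c_1$ with parameters shifted to $g+M-N$ (L), $(g+M-N,h-M+N)$ (J), and $C_1^-$ be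 $c_1$ with parameters $g+M-N-1$ (L), $(g+M-N-1,h-M+N-1)$ (J). Then $$\widetilde{\mathcal H}_{\mathcal D}=-4\Bigl(c_2\frac{d^2}{d\eta^2}+\Bigl(C_1-2c_2\frac{\Xi_{\mathcal D}'}{\Xi_{\mathcal D}}\Bigr)\frac{d}{d\eta}+c_2\frac{\Xi_{\mathcal D}''}{\Xi_{\mathcal D}}-C_1^-\frac{\Xi_{\mathcal D}'}{\Xi_{\mathcal D}}\Bigr).$$ It is known that $\widetilde{\mathcal H}_{\mathcal D}P_{\mathcal D,n}=\mathcal E(n)P_{\mathcal D,n}$ for all $n\ge0$. **Matrices.** Let $\eta_1,\dots,\eta_{\widetilde{\mathcal N}}$ be the zeros of $P_{\mathcal D,\mathcal N}$. The sinusoidal coordinate is $\eta(x)=x^2$ (L), $\eta(x)=\cos 2x$ (J); choose $x_n\in\mathbb C$ with $\eta(x_n)=\eta_n$ and write $\dot\eta(x)=d\eta/dx$ (so $\dot\eta(x_n)^2=4c_2(\eta_n)$). Define $$\widetilde{\mathcal M}_{nm}=\frac{\Bigl[\bigl(\widetilde{\mathcal H}_{\mathcal D}-\mathcal E(\mathcal N)\bigr)\prod_{j\ne m}(\eta-\eta_j)\Bigr]_{\eta=\eta_n}}{\prod_{j\ne n}(\eta_n-\eta_j)},\qquad \mathcal M_{nm}=-\frac{\dot\eta(x_m)}{\dot\eta(x_n)}\widetilde{\mathcal M}_{nm}.$$ **Standing assumption.** $P_{\mathcal D,\mathcal N}$ has degree exactly $\widetilde{\mathcal N}$, its zeros are pairwise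 distinct, none equals $0$ (L) or $\pm1$ (J), and none is a zero of $\Xi_{\mathcal D}$. *)

(* Defs.v *)
From HB Require Import structures.
From mathcomp Require Import all_boot all_order all_algebra complex.
From mathcomp Require Import all_classical all_reals all_analysis.

Set Implicit Arguments.
Unset Strict Implicit.
Unset Printing Implicit Defensive.

Import Order.TTheory GRing.Theory Num.Theory numFieldNormedType.Exports.

Local Open Scope classical_set_scope.
Local Open Scope ring_scope.

(* The case together with its parameters: [Laguerre g] or [Jacobi g h]. *)
Variant system (R : Type) : Type :=
  | Laguerre of R
  | Jacobi of R & R.

Section RealSide.
Variable R : realType.
Implicit Types (s : system R) (dI dII : seq nat) (v n : nat) (x : R).

(* Pochhammer symbol (a)_n = a (a + 1) ... (a + n - 1). *)
Definition rising (a : R) n : R := \prod_(i < n) (a + i%:R).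

(* L_n^(a)(X) = \sum_k (-1)^k (a+k+1)_(n-k) / (k! (n-k)!) X^k *)
Definition laguerre_poly n (a : R) : {poly R} :=
  \poly_(k < n.+1)
    ((-1) ^+ k * rising (a + k%:R + 1) (n - k) / (k`! * (n - k)`!)%:R).

(* P_n^(a,b)(X)
     = \sum_k (n+a+b+1)_k (a+k+1)_(n-k) / (k! (n-k)!) ((X-1)/2)^k;
   no division by (a+1)_k, so this is the usual polynomial for all real a, b,
   negative integers included. *)
Definition jacobi_poly n (a b : R) : {poly R} :=
  \sum_(k < n.+1)
    (rising (n%:R + a + b + 1) k * rising (a + k%:R + 1) (n - k)
      / (k`! * (n - k)`!)%:R) *: (2^-1 *: ('X - 1)) ^+ k.

Definition classical_poly s n : {poly R} :=
  match s with
  | Laguerre g => laguerre_poly n (g - 1/2)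
  | Jacobi g h => jacobi_poly n (g - 1/2) (h - 1/2)
  end.

Definition muI s v : R -> R :=
  match s with
  | Laguerre g => fun x => expR x * (laguerre_poly v (g - 1/2)).[- x]
  | Jacobi g h => fun x =>
      ((1 + x) / 2) `^ (1/2 - h) * (jacobi_poly v (g - 1/2) (1/2 - h)).[x]
  end.

Definition muII s v : R -> R :=
  match s with
  | Laguerre g => fun x => x `^ (1/2 - g) * (laguerre_poly v (1/2 - g)).[x]
  | Jacobi g h => fun x =>
      ((1 - x) / 2) `^ (1/2 - g) * (jacobi_poly v (1/2 - g) (h - 1/2)).[x]
  end.

Definition wronskian (fs : seq (R -> R)) x : R :=
  \det (\matrix_(i < size fs, j < size fs)
          derive1n i (nth (fun=> 0) fs j : R -> R^o) x).

(* The multi-index is a pair of lists, so the labels I and II are data. *)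
Definition multi_index dI dII : Prop :=
  [/\ sorted ltn dI, sorted ltn dII,
      {in dI, forall d, 0 < d}%N, {in dII, forall d, 0 < d}%N
    & (0 < size dI + size dII)%N].

Definition admissible s dI dII : Prop :=
  match s with
  | Laguerre g =>
      (size dII)%:R + 3/2 < g /\ {in dII, forall d, d%:R + 1/2 < g}
  | Jacobi g h =>
      [/\ (size dII)%:R + 2 < g, {in dII, forall d, d%:R + 1/2 < g},
          (size dI)%:R + 2 < h & {in dI, forall d, d%:R + 1/2 < h}]
  end.

Definition seeds s dI dII : seq (R -> R) :=
  [seq muI s d | d <- dI] ++ [seq muII s d | d <- dII].

Definition prefactor s (M N : nat) (e x : R) : R :=
  match s with
  | Laguerre g => x `^ ((M%:R + g + e) * N%:R) * expR (- (M%:R * x))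
  | Jacobi g h => ((1 - x) / 2) `^ ((M%:R + g + e) * N%:R)
                  * ((1 + x) / 2) `^ ((N%:R + h + e) * M%:R)
  end.

(* Interval on which the real powers occurring in [muI], [muII] and
   [prefactor] are the genuine smooth ones. *)
Definition eta_range s : set R :=
  match s with
  | Laguerre _ => [set x | 0 < x]
  | Jacobi _ _ => [set x | -1 < x < 1]
  end.

(* A polynomial is determined by its values on [eta_range s]; the following
   two predicates therefore characterize Xi_D and P_{D,n} uniquely. *)
Definition is_Xi s dI dII (Xi : {poly R}) : Prop :=
  forall x, eta_range s x ->
    Xi.[x] = wronskian (seeds s dI dII) x
             * prefactor s (size dI) (size dII) (- (1/2)) x.

Definition is_PD s dI dII n (P : {poly R}) : Prop :=
  forall x, eta_range s x ->
    P.[x] = wronskian (rcons (seeds s dI dII) (horner (classical_poly s n))) x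
            * prefactor s (size dI) (size dII) (1/2) x.

(* 'C(M, 2) = M (M - 1) / 2; for a multi-index the natural-number subtractions
   do not truncate, since the sum of M distinct positive integers is at least
   M (M + 1) / 2. *)
Definition ell dI dII : nat :=
  (sumn dI - 'C(size dI, 2)) + (sumn dII - 'C(size dII, 2))
  + size dI * size dII.

Definition energy s n : R :=
  match s with
  | Laguerre _ => 4 * n%:R
  | Jacobi g h => 4 * n%:R * (n%:R + g + h)
  end.

Definition c2 s : {poly R} :=
  match s with
  | Laguerre _ => 'X
  | Jacobi _ _ => 1 - 'X^2
  end.

Definition c1 s : {poly R} :=
  match s with
  | Laguerre g => (g + 1/2)%:P - 'X
  | Jacobi g h => (h - g)%:P - (g + h + 1) *: 'X
  end.

Definition shift_params s (a : R) : system R :=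
  match s with
  | Laguerre g => Laguerre (g + a)
  | Jacobi g h => Jacobi (g + a) (h - a)
  end.

Definition lower_params s : system R :=
  match s with
  | Laguerre g => Laguerre (g - 1)
  | Jacobi g h => Jacobi (g - 1) (h - 1)
  end.

End RealSide.

Section ComplexSide.
Variable R : realType.
Local Open Scope complex_scope.
Implicit Types (s : system R) (z : R[i]).

Definition complexify (p : {poly R}) : {poly R[i]} := map_poly (real_complex R) p.

Definition expC z : R[i] :=
  let: a +i* b := z in (expR a * cos b) +i* (expR a * sin b).

Definition cosC z : R[i] := (expC ('i * z) + expC (- ('i * z))) / 2.

Definition sinusoidal s : R[i] -> R[i] :=
  match s with
  | Laguerre _ => fun z => z ^+ 2
  | Jacobi _ _ => fun z => cosC (2 * z)
  end.

(* Complex derivative of [sinusoidal s]. *)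
Definition sinusoidal_dot s : R[i] -> R[i] :=
  derive1 (sinusoidal s : R[i] -> R[i]^o).

Definition regular_point s z : Prop :=
  match s with
  | Laguerre _ => z <> 0
  | Jacobi _ _ => z <> 1 /\ z <> -1
  end.

(* Value at [z] of the operator applied to the polynomial [q]; meaningful where
   Xi does not vanish. *)
Definition Htilde s (M N : nat) (Xi : {poly R}) (q : {poly R[i]}) z : R[i] :=
  let C2 := (complexify (c2 s)).[z] in
  let sMN := shift_params s (M%:R - N%:R) in
  let C1 := (complexify (c1 sMN)).[z] in
  let C1m := (complexify (c1 (lower_params sMN))).[z] in
  let X := complexify Xi in
  - 4 * (C2 * q^`(2).[z]
         + (C1 - 2 * C2 * (X^`().[z] / X.[z])) * q^`().[z]
         + (C2 * (X^`(2).[z] / X.[z]) - C1m * (X^`().[z] / X.[z])) * q.[z]).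

Section Matrices.
Variables (s : system R) (M N : nat) (Xi : {poly R}) (n0 : nat) (K : nat).
Variables (eta xs : 'I_K -> R[i]).

Definition node_poly (m : 'I_K) : {poly R[i]} :=
  \prod_(j < K | j != m) ('X - (eta j)%:P).

Definition Mtilde : 'M[R[i]]_K :=
  \matrix_(n, m)
    ((Htilde s M N Xi (node_poly m) (eta n)
      - (energy s n0)%:C * (node_poly m).[eta n])
     / \prod_(j < K | j != n) (eta n - eta j)).

Definition Mmat : 'M[R[i]]_K :=
  \matrix_(n, m)
    (- (sinusoidal_dot s (xs m) / sinusoidal_dot s (xs n)) * Mtilde n m).

Definition eigvec (Pm PN : {poly R}) : 'cV[R[i]]_K :=
  \col_n ((complexify Pm).[eta n]
          / (sinusoidal_dot s (xs n) * (complexify PN)^`().[eta n])).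

End Matrices.
End ComplexSide.

(* Main.v *)
Require Import Defs.
From HB Require Import structures.
From mathcomp Require Import all_boot all_order all_algebra complex.
From mathcomp Require Import all_classical all_reals all_analysis.
From mathcomp Require Import perm ring lra zify.

(** Put X = W[f_1, ..., f_r] and Y = W[f_1, ..., f_r, y], where the f_j and y are
    eigenfunctions of L = c2 D^2 + c1 D.  Evaluating the sum of the row-wise
    derivations induced by L on X and on Y also column-wise (where L acts by the
    eigenvalues) gives one linear relation for each, and a three-term Plücker
    relation links them; together they yield a bilinear differential equation
    for the pair (X, Y), with no division and no induction on r.  The gauge
    prefactors turn it into the eigenvalue equation for P_{D,n}.

    P_{D,n} is nonzero, as otherwise y would be, pointwise, a combination of
    eigenfunctions belonging to other eigenvalues.  Its degree is controlled by
    the leading coefficient of the bilinear equation (L) or by a direct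
    estimate of the determinant (J).  So, for m < N, the polynomial P_{D,m} equals
    its Lagrange interpolant at the zeros of P_{D,N}, and the eigenvector
    identity is the eigenvalue equation for P_{D,m} evaluated at those zeros. *)

(** A Darboux chain would add the seeds one at a time and need every intermediate Wronskian to be
    nonzero. The pointwise identity used here needs only X to be nonzero at the given point, and
    zeros of X become harmless once polynomial identities are multiplied by Xi. Real powers confine
    the calculus to an open real interval; the resulting polynomial identities then hold at the
    complex zeros.

    Eigenvalues separate y from the seeds by sign: under admissibility those of the seeds are
    positive, while that of P_n is -E(n)/4 <= 0.

    The degree hypothesis concerns P_{D,N} alone, so deg P_{D,m} has to be found, and the two cases
    resist each other's method. With delta = deg P - deg Xi, the leading coefficient in case J gives
    (n - delta)(n + delta + g + h) = 0, leaving a second root to exclude. In case L the relation is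
    linear in delta, but the factor e^eta keeps type I columns from losing degree under
    differentiation, so a term-by-term estimate of the determinant would be too weak. *)

Set Implicit Arguments.
Unset Strict Implicit.
Unset Printing Implicit Defensive.

Import Order.TTheory GRing.Theory Num.Theory numFieldNormedType.Exports.

Local Open Scope classical_set_scope.
Local Open Scope ring_scope.

(** * Wronskian-like determinants *)

(* [F p j] stands for the [p]-th derivative of the [j]-th function; the rows are
   the derivatives of orders [rho 0], ..., [rho (k - 1)]. *)
Definition rowdet (K : nzRingType) (F : nat -> nat -> K) (k : nat)
    (rho : nat -> nat) : K := \det (\matrix_(i < k, j < k) F (rho i) j).

(** Differentiating a determinant row by row produces the terms [raise 1 i rho]. *)
Definition raise (e i : nat) (rho : nat -> nat) : nat -> nat :=
  fun p => (rho p + (p == i) * e)%N.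

Lemma raise_same e i rho : raise e i rho i = (rho i + e)%N.
Proof. by rewrite /raise eqxx mul1n. Qed.

Lemma raise_other e i rho p : p != i -> raise e i rho p = rho p.
Proof. by move=> /negbTE h; rewrite /raise h mul0n addn0. Qed.

Section RowDeterminants.
Variable K : comNzRingType.
Implicit Types (F : nat -> nat -> K) (rho : nat -> nat).

Lemma eq_rowdet F k rho1 rho2 :
  (forall i, (i < k)%N -> rho1 i = rho2 i) -> rowdet F k rho1 = rowdet F k rho2.
Proof.
by move=> e; congr (\det _); apply/matrixP => i j; rewrite !mxE e.
Qed.

Lemma rowdet_dup F k rho i1 i2 : (i1 < k)%N -> (i2 < k)%N -> i1 != i2 ->
  rho i1 = rho i2 -> rowdet F k rho = 0.
Proof.
move=> h1 h2 ne e.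
apply: (@determinant_alternate _ _ _ (Ordinal h1) (Ordinal h2)) => //.
by move=> j; rewrite !mxE /= e.
Qed.

Lemma rowdet_swap F k rho1 rho2 i1 i2 : (i1 < k)%N -> (i2 < k)%N -> i1 != i2 ->
  rho1 i1 = rho2 i2 -> rho1 i2 = rho2 i1 ->
  (forall i, i != i1 -> i != i2 -> rho1 i = rho2 i) ->
  rowdet F k rho1 = - rowdet F k rho2.
Proof.
move=> h1 h2 ne e1 e2 e.
pose s := tperm (Ordinal h1) (Ordinal h2).
rewrite /rowdet.
have -> : (\matrix_(i < k, j < k) F (rho1 i) j)
          = row_perm s (\matrix_(i < k, j < k) F (rho2 i) j).
  apply/matrixP => i j; rewrite !mxE; congr (F _ _).
  case: tpermP => [->|->|/eqP n1 /eqP n2] //=.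
  by apply: e; [move: n1|move: n2]; rewrite -val_eqE.
by rewrite row_permE det_mulmx det_perm odd_tperm -val_eqE /= ne mulN1r.
Qed.

Lemma rowdet_cofactor F k rho e (i : 'I_k) :
  rowdet F k (raise e i rho)
  = \sum_(j < k) F (rho i + e)%N j * cofactor (\matrix_(i < k, j < k) F (rho i) j) i j.
Proof.
rewrite /rowdet (expand_det_row _ i); apply: eq_bigr => j _.
rewrite !mxE /raise eqxx mul1n; congr (_ * (_ * \det _)).
apply/matrixP => a b; rewrite !mxE.
have -> : (val (lift i a) == val i) = false.
  by rewrite val_eqE eq_sym (negbTE (neq_lift i a)).
by rewrite mul0n addn0.
Qed.

(** The double sum is the trace of [B] times the adjugate of [A]. Read by rows, it adds up the
    determinants in which one row of [A] is replaced by that of [B]; read by columns, column [j]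
    contributes [lam j] times the determinant. *)
Lemma sum_cofactor_col_scaled k (A B : 'M[K]_k) (lam : 'I_k -> K) :
  (forall i j, B i j = lam j * A i j) ->
  \sum_i \sum_j B i j * cofactor A i j = (\sum_j lam j) * \det A.
Proof.
move=> e; rewrite exchange_big /= mulr_suml; apply: eq_bigr => j _.
rewrite (expand_det_col A j) mulr_sumr; apply: eq_bigr => i _.
by rewrite e -mulrA.
Qed.

Lemma rowdet_raise1 F n i : (i < n)%N -> rowdet F n.+1 (raise 1 i id) = 0.
Proof.
move=> lin; apply: (@rowdet_dup _ _ _ i i.+1); rewrite ?ltnS ?(ltnW lin) //.
  by rewrite neq_ltn ltnSn.
by rewrite raise_same raise_other ?addn1 // neq_ltn ltnSn orbT.
Qed.

(** For [i < n - 1] both determinants have a repeated row; for [i = n - 1] the last two rows have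
    orders [n + 1, n] on the left and [n, n + 1] on the right. In this uniform shape the terms match
    those of the second derivative of the Wronskian. *)
Lemma rowdet_raise2 F n i : (i < n)%N ->
  rowdet F n.+1 (raise 2 i id) = - rowdet F n.+1 (raise 1 i (raise 1 n id)).
Proof.
move=> lin; have ne : i != n by rewrite neq_ltn lin.
have ne' : n != i by rewrite eq_sym.
have := lin; rewrite leq_eqVlt => /predU1P[e|lin2].
  apply: (@rowdet_swap _ _ _ _ i n); rewrite ?ltnS ?(ltnW lin) //.
  - by rewrite raise_same (raise_other _ _ ne') raise_same addn2 addn1 e.
  - by rewrite raise_same !raise_other //= addn1 e.
  - by move=> p h1 h2; rewrite !raise_other.
have l2 : (i.+2 < n.+1)%N by rewrite ltnS.
have n1 : i.+1 != i by rewrite neq_ltn ltnSn orbT.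
have n2 : i.+2 != i by rewrite neq_ltn ltnS leqnSn orbT.
have n3 : i.+1 != n by rewrite neq_ltn lin2.
rewrite (@rowdet_dup _ _ _ i i.+2) ?ltnS ?(ltnW lin) //.
- rewrite (@rowdet_dup _ _ (raise 1 i _) i i.+1) ?oppr0 ?ltnS ?(ltnW lin) //.
    by rewrite eq_sym.
  by rewrite raise_same !raise_other // addn1.
- by rewrite eq_sym.
- by rewrite raise_same raise_other // addn2.
Qed.

(** The operator is applied to one row at a time and the determinants are summed. Among the [b i]
    only [b n] survives, since raising any other row by one repeats a row, whereas each [c i] just
    multiplies the determinant. *)
Lemma row_ode_rowdet F n (lam : nat -> K) (c2 : K) (b c : nat -> K) :
  (forall i j, (j < n.+1)%N ->
     c2 * F i.+2 j + b i * F i.+1 j + c i * F i j = lam j * F i j) ->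
  c2 * (rowdet F n.+1 (raise 2 n id)
          - \sum_(i < n) rowdet F n.+1 (raise 1 i (raise 1 n id)))
  + b n * rowdet F n.+1 (raise 1 n id)
  + (\sum_(i < n.+1) c i) * rowdet F n.+1 id
  = (\sum_(j < n.+1) lam j) * rowdet F n.+1 id.
Proof.
move=> h; pose A := \matrix_(i < n.+1, j < n.+1) F i j.
have Ae : rowdet F n.+1 id = \det A by [].
pose B := \matrix_(i < n.+1, j < n.+1)
  (c2 * F i.+2 j + b i * F i.+1 j + c i * F i j).
have /sum_cofactor_col_scaled <- :
    forall i j, B i j = lam (val j) * A i j.
  by move=> i j; rewrite !mxE h.
transitivity (\sum_(i < n.+1) (c2 * rowdet F n.+1 (raise 2 i id)
   + b i * rowdet F n.+1 (raise 1 i id) + c i * rowdet F n.+1 id)); last first.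
  apply: eq_bigr => i _.
  rewrite !rowdet_cofactor Ae (expand_det_row A i) !mulr_sumr -!big_split /=.
  by apply: eq_bigr => j _; rewrite !mxE addn1 addn2; ring.
rewrite !big_split /= -!mulr_sumr -mulr_suml; congr (_ + _ + _).
  congr (_ * _); rewrite big_ord_recr /= addrC -sumrN; congr (_ + _).
  by apply: eq_bigr => i _; rewrite rowdet_raise2 ?opprK.
rewrite big_ord_recr /= big1 ?add0r // => i _.
by rewrite rowdet_raise1 ?mulr0.
Qed.
End RowDeterminants.

Section Border.
Variables (K : fieldType) (F : nat -> nat -> K) (n : nat) (a t : nat -> K).
Hypothesis tE : forall p, F p n - \sum_(j < n) a j * F p j = t p.

(** The last column may be replaced by the residual [t] because its cofactors are orthogonal to
    every other column. These cofactors involve the first [n] columns only, so they are minors of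
    the unbordered table. *)
Lemma rowdet_last_col rho :
  rowdet F n.+1 rho
  = \sum_(i < n.+1) t (rho i) * ((-1) ^+ (i + n) * rowdet F n (rho \o bump i)).
Proof.
pose A := \matrix_(i < n.+1, j < n.+1) F (rho i) j.
have cofE i : cofactor A i ord_max = (-1) ^+ (i + n) * rowdet F n (rho \o bump i).
  congr (_ * \det _); apply/matrixP => p q; rewrite !mxE /=.
  by rewrite [bump n q]/bump leqNgt ltn_ord.
have zero j : \sum_i A i (widen_ord (leqnSn n) j) * cofactor A i ord_max = 0.
  have := congr1 (fun M : 'M[K]_n.+1 => M ord_max (widen_ord (leqnSn n) j))
    (mul_adj_mx A).
  rewrite !mxE -val_eqE /= (gtn_eqF (ltn_ord j)) mulr0n => h; rewrite -[RHS]h.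
  by apply: eq_bigr => i _; rewrite !mxE mulrC.
rewrite /rowdet -/A (expand_det_col A ord_max).
transitivity (\sum_i A i ord_max * cofactor A i ord_max
  - \sum_(j < n) a j * \sum_i A i (widen_ord (leqnSn n) j) * cofactor A i ord_max).
  by rewrite [X in _ - X]big1 ?subr0 // => j _; rewrite zero mulr0.
under [X in _ - X]eq_bigr do rewrite mulr_sumr.
rewrite exchange_big -sumrB; apply: eq_bigr => i _.
rewrite cofE -tE mulrBl mulr_suml !mxE; congr (_ - _); apply: eq_bigr => j _.
by rewrite !mxE /= -!mulrA.
Qed.
End Border.

Section PivotRows.
Variables (K : fieldType) (F : nat -> nat -> K) (n : nat).
Hypothesis X_neq0 : rowdet F n.+1 id != 0.

Lemma rowdet_solve (y : nat -> K) :
  exists a : nat -> K, forall p, (p < n.+1)%N -> y p = \sum_(j < n.+1) a j * F p j.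
Proof.
pose A := \matrix_(i < n.+1, j < n.+1) F i j.
have uA : A \in unitmx by rewrite unitmxE unitfE.
pose v := invmx A *m \col_(i < n.+1) y i.
exists (fun j => v (inord j) 0) => p ltp.
have := congr1 (fun M : 'cV[K]_n.+1 => M (Ordinal ltp) 0)
  (mulKVmx uA (\col_(i < n.+1) y i)).
rewrite -/v !mxE => <-; apply: eq_bigr => j _.
by rewrite !mxE inord_val mulrC.
Qed.

Lemma rowdet_indep (a : nat -> K) :
  (forall p, (p < n.+1)%N -> \sum_(j < n.+1) a j * F p j = 0) ->
  forall j, (j < n.+1)%N -> a j = 0.
Proof.
move=> h j ltj; pose A := \matrix_(i < n.+1, j < n.+1) F i j.
have uA : A \in unitmx by rewrite unitmxE unitfE.
have A0 : A *m \col_j a j = 0.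
  apply/matrixP => p q; rewrite !mxE -[RHS](h p) //; apply: eq_bigr => i _.
  by rewrite !mxE mulrC.
have := congr1 (fun M : 'cV[K]_n.+1 => M (Ordinal ltj) 0) (mulKmx uA (\col_j a j)).
by rewrite A0 mulmx0 !mxE.
Qed.

(** At the given point, [a] makes a combination of the first columns agree with the bordering column
    through order [n]. The residual [t] starts at order [n + 1], so the expansions along the last
    column have one or two terms. Multiplying the last identity by [rowdet F n.+1 id] and
    eliminating [t] by the two before it gives the three-term Plücker relation. *)
Lemma border_expand : exists a : nat -> K,
  let t p := F p n.+1 - \sum_(j < n.+1) a j * F p j in
  [/\ forall p, (p < n.+1)%N -> t p = 0,
      rowdet F n.+2 id = t n.+1 * rowdet F n.+1 id,
      rowdet F n.+2 (raise 1 n.+1 id) = t n.+2 * rowdet F n.+1 id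
    & rowdet F n.+2 (raise 1 n (raise 1 n.+1 id))
      = t n.+2 * rowdet F n.+1 (raise 1 n id)
        - t n.+1 * rowdet F n.+1 (raise 2 n id)].
Proof.
have [a ha] := rowdet_solve (F ^~ n.+1); exists a => t.
have tE p : F p n.+1 - \sum_(j < n.+1) a j * F p j = t p by [].
have t0 p : (p < n.+1)%N -> t p = 0 by move=> ltp; rewrite /t -ha ?subrr.
have sgn (m : nat) : (-1) ^+ (m + m) = 1 :> K by rewrite -signr_odd oddD addbb.
have ne : n != n.+1 by rewrite neq_ltn ltnSn.
have ne' : n.+1 != n by rewrite eq_sym.
split=> //.
- rewrite (rowdet_last_col tE) big_ord_recr /= big1 ?add0r.
    rewrite sgn mul1r; congr (_ * _); apply: eq_rowdet => i lti /=.
    by rewrite /bump leqNgt lti.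
  by move=> i _; rewrite t0 ?mul0r.
- rewrite (rowdet_last_col tE) big_ord_recr /= big1 ?add0r.
    rewrite sgn mul1r raise_same addn1; congr (_ * _).
    apply: eq_rowdet => i lti /=.
    by rewrite /bump leqNgt lti raise_other // neq_ltn lti.
  by move=> i _; rewrite raise_other ?t0 ?mul0r // neq_ltn ltn_ord.
- rewrite (rowdet_last_col tE) 2!big_ord_recr /= big1 ?add0r.
    rewrite addnS exprS !sgn mulr1 raise_same !(raise_other _ _ ne).
    rewrite (raise_other _ _ ne') raise_same !addn1 addrC; congr (_ + _).
      rewrite mul1r; congr (_ * _); apply: eq_rowdet => i lti /=.
      rewrite /bump leqNgt lti /= /raise (ltn_eqF lti) /=.
      by rewrite mul0n addn0.
    rewrite mulN1r mulrN; congr (- (_ * _)); apply: eq_rowdet => i lti /=.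
    move: lti; rewrite ltnS leq_eqVlt => /predU1P[->|lti].
      by rewrite /bump leqnn add1n raise_other // !raise_same addn1 addn2.
    have h1 : i != n by rewrite neq_ltn lti.
    have h2 : i != n.+1 by rewrite neq_ltn ltnS (ltnW lti).
    by rewrite /bump leqNgt lti /= add0n !raise_other.
  move=> i _; have lti := ltn_ord i.
  have h1 : (i : nat) != n by rewrite neq_ltn lti.
  have h2 : (i : nat) != n.+1 by rewrite neq_ltn ltnS (ltnW lti).
  by rewrite !raise_other ?t0 ?mul0r //= ltnS (ltnW lti).
Qed.
End PivotRows.

(** * The pointwise bilinear relation between a Wronskian and its bordering *)

Section Bilinear.
Variables (K : fieldType) (F : nat -> nat -> K) (n : nat).
Variables (c2 d2 e2 c1 d1 : K) (lam : nat -> K).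
Hypothesis X_neq0 : rowdet F n.+1 id != 0.
(* [d2], [e2] are the derivatives of [c2], and [d1] that of [c1]: this is the
   [i]-th derivative of the equation [c2 f'' + c1 f' = lam f]. *)
Hypothesis F_ode : forall i j, (j < n.+2)%N ->
  c2 * F i.+2 j + (i%:R * d2 + c1) * F i.+1 j
  + ('C(i, 2)%:R * e2 + i%:R * d1) * F i j = lam j * F i j.

Lemma rowdet_bilinear :
  let X := rowdet F n.+1 id in
  let X1 := rowdet F n.+1 (raise 1 n id) in
  let X2 := \sum_(i < n.+1) rowdet F n.+1 (raise 1 i (raise 1 n id)) in
  let Y := rowdet F n.+2 id in
  let Y1 := rowdet F n.+2 (raise 1 n.+1 id) in
  let Y2 := \sum_(i < n.+2) rowdet F n.+2 (raise 1 i (raise 1 n.+1 id)) in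
  c2 * (Y2 * X - 2 * Y1 * X1 + Y * X2)
  + (n.+1%:R * d2 + c1) * Y1 * X - (n%:R * d2 + c1) * X1 * Y
  = (lam n.+1 - 'C(n.+1, 2)%:R * e2 - n.+1%:R * d1) * X * Y.
Proof.
move=> X X1 X2 Y Y1 Y2.
have rr k G : rowdet G k.+1 (raise 1 k (raise 1 k id)) = rowdet G k.+1 (raise 2 k id) :> K.
  apply: eq_rowdet => i _; rewrite /raise -addnA -mulnDr //.
have hX := @row_ode_rowdet _ F n lam c2 (fun i => i%:R * d2 + c1)
  (fun i => 'C(i, 2)%:R * e2 + i%:R * d1) (fun i j lj => F_ode i (ltnW lj)).
have hY := @row_ode_rowdet _ F n.+1 lam c2 (fun i => i%:R * d2 + c1)
  (fun i => 'C(i, 2)%:R * e2 + i%:R * d1) F_ode.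
have [a] := border_expand X_neq0; set t := fun p => _; case=> t0 Ye Y1e Y11e.
have Y11z : \sum_(i < n) rowdet F n.+2 (raise 1 (widen_ord (leqnSn n) i) (raise 1 n.+1 id)) = 0.
  apply: big1 => i _; have lti := ltn_ord i.
  have h : i.+1 != n.+1 :> nat by rewrite neq_ltn ltnS lti.
  apply: (@rowdet_dup _ _ _ _ i i.+1); rewrite ?ltnS ?(ltnW lti) //.
  - by rewrite ltnW // ltnW.
  - by rewrite neq_ltn ltnSn.
  - have h1 : i != n.+1 :> nat by rewrite neq_ltn ltnS (ltnW lti).
    have h2 : i.+1 != i by rewrite neq_ltn ltnSn orbT.
    by rewrite /= raise_same !raise_other ?addn1.
have X2e : X2 = \sum_(i < n) rowdet F n.+1 (raise 1 i (raise 1 n id))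
                + rowdet F n.+1 (raise 2 n id).
  by rewrite /X2 big_ord_recr /= rr.
have Y2e : Y2 = t n.+2 * X1 - t n.+1 * rowdet F n.+1 (raise 2 n id)
                + rowdet F n.+2 (raise 2 n.+1 id).
  by rewrite /Y2 big_ord_recr /= rr -Y11e big_ord_recr /= Y11z add0r.
move: hX hY; rewrite [in X in _ -> X -> _]big_ord_recr /= Y11z add0r Y11e.
rewrite -/X -/X1 -/Y -/Y1 (big_ord_recr n.+1) (big_ord_recr n.+1) /=.
set S := \sum_(i < n.+1) _; set L := \sum_(i < n.+1) _.
move: X2e Y2e Ye Y1e; rewrite -/X -/X1 -/Y -/Y1.
set x2 := rowdet _ _ _; set y2 := rowdet _ _ _.
set x11 := \sum_(i < n) rowdet _ _ _; set t1 := t n.+1; set t2 := t n.+2.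
move=> -> -> -> -> hX hY.
have comb u v p q r r' : p = q -> r = r' -> u * (p - q) - v * (r - r') = 0 :> K.
  by move=> -> ->; rewrite !subrr !mulr0 subrr.
(* [X] times the relation for [Y], minus [Y = t1 * X] times the relation for [X]. The sums [S] and
   [L] occur in both and cancel, leaving only the terms of index [n + 1]. *)
have := comb X (t1 * X) _ _ _ _ hY hX => h.
by apply/eqP; rewrite -subr_eq0; apply/eqP; rewrite -[RHS]h; ring.
Qed.

(** Vanishing of [Y] and [Y'] extends the agreement through order [n + 2], the highest order in the
    equation for row [n]. Applying the equations then gives a relation with coefficients
    [a j * (lam j - lam n.+1)] in the rows up to [n], so all [a j] vanish. The [a j] belong to one
    point and are never differentiated. *)
Lemma rowdet_border_eq0 :
  (forall j, (j < n.+1)%N -> lam j != lam n.+1) ->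
  rowdet F n.+2 id = 0 -> rowdet F n.+2 (raise 1 n.+1 id) = 0 -> F 0 n.+1 = 0.
Proof.
move=> lamNe Y0 Y10; have [a] := border_expand X_neq0; set t := fun p => _.
case=> t0 Ye Y1e _; have tz p : (p < n.+3)%N -> t p = 0.
  rewrite ltnS leq_eqVlt => /predU1P[->|].
    by apply: (mulIf X_neq0); rewrite -Y1e Y10 mul0r.
  rewrite ltnS leq_eqVlt => /predU1P[->|]; last exact: t0.
  by apply: (mulIf X_neq0); rewrite -Ye Y0 mul0r.
have yE p : (p < n.+3)%N -> F p n.+1 = \sum_(j < n.+1) a j * F p j.
  by move=> /tz /eqP; rewrite subr_eq0 => /eqP.
have a0 j : (j < n.+1)%N -> a j = 0.
  move=> ltj; apply: (mulIf (_ : lam j - lam n.+1 != 0)).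
    by rewrite subr_eq0 lamNe.
  rewrite mul0r.
  apply: (@rowdet_indep _ _ _ X_neq0 (fun j => a j * (lam j - lam n.+1))) ltj => p ltp.
  transitivity (\sum_(j < n.+1) a j * (lam j * F p j)
                - lam n.+1 * \sum_(j < n.+1) a j * F p j).
    by rewrite mulr_sumr -sumrB; apply: eq_bigr => i _; ring.
  rewrite -yE ?(leq_trans ltp) ?ltnS ?leqW //.
  rewrite -(F_ode p (ltnSn _)) !yE ?(leq_trans ltp) ?ltnS ?leqW //.
  rewrite !mulr_sumr -!big_split /= -sumrB; apply: big1 => i _.
  by rewrite -(F_ode p (ltnW (ltn_ord i))); ring.
by rewrite yE // big1 // => j _; rewrite a0 ?mul0r.
Qed.
End Bilinear.

(** * Degree bounds for polynomials and for determinants of polynomials *)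

Section PolynomialSizes.
Variable R : comNzRingType.

Lemma size_mul_bound (p q : {poly R}) a b :
  (size p <= a)%N -> (size q <= b)%N -> (size (p * q)%R <= (a + b).-1)%N.
Proof.
move=> ha hb; apply: leq_trans (size_polyMleq _ _) _.
by rewrite -!subn1 leq_sub2r // leq_add.
Qed.

(** The Euler operator multiplies [X^j] by [j], so the leading terms cancel. *)
Lemma size_euler (p : {poly R}) :
  (size ('X * p^`() - (size p).-1%:R *: p)%R <= (size p).-1)%N.
Proof.
apply/leq_sizeP => j hj; rewrite coefB coefXM coefZ.
have -> : (if j == 0%N then 0 else p^`()`_j.-1) = j%:R * p`_j.
  by case: (j) => [|i]; rewrite /= ?mul0r // coef_deriv mulr_natl.
have [->|ne] := eqVneq j (size p).-1; first by rewrite subrr.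
rewrite nth_default ?mulr0 ?subrr //.
by move: hj; rewrite leq_eqVlt eq_sym (negbTE ne) /=; case: (size p).
Qed.

Lemma size_Xderiv2 (p : {poly R}) : (size ('X * p^`()^`())%R <= (size p).-1)%N.
Proof.
apply/leq_sizeP => j hj; rewrite coefXM; case: j hj => [|j] //= hj.
by rewrite !coef_deriv nth_default ?mul0rn //; case: (size p) hj.
Qed.

Lemma size_deriv_pred (p : {poly R}) : (size p^`() <= (size p).-1)%N.
Proof. exact: size_poly. Qed.

Lemma size_det_bound m (A : 'M[{poly R}]_m) (a b : 'I_m -> nat) :
  (forall i j, size (A i j) <= (a i + b j).+1)%N ->
  (size (\det A) <= (\sum_i a i + \sum_j b j).+1)%N.
Proof.
move=> hA; rewrite /determinant.
have hsum (I : Type) (r : seq I) (F : I -> {poly R}) c :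
  (forall i, size (F i) <= c)%N -> (size (\sum_(i <- r) F i)%R <= c)%N.
  move=> hF; elim/big_ind: _ => [|p q hp hq|i _]; rewrite ?size_poly0 //.
  by rewrite (leq_trans (size_polyD _ _)) // geq_max hp.
apply: hsum => t; rewrite -signr_odd mulr_sign.
have hp : (size (\prod_i A i (t i))%R <= (\sum_i a i + \sum_j b j).+1)%N.
  have -> : (\sum_j b j = \sum_i b (t i))%N by rewrite (reindex_inj (@perm_inj _ t)).
  rewrite -big_split /=; elim/big_ind2: _ => [|p u q v hp hq|i _] //.
    by rewrite size_poly1.
  by apply: leq_trans (size_mul_bound hp hq) _; rewrite addnS addSn.
by case: ifP; rewrite ?size_polyN.
Qed.

Lemma det_scale_rows_cols m (u v : 'I_m -> R) (B : 'M[R]_m) :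
  \det (\matrix_(i, j) (u i * v j * B i j)) = (\prod_i u i) * (\prod_j v j) * \det B.
Proof.
have -> : \matrix_(i, j) (u i * v j * B i j)
    = diag_mx (\row_i u i) *m B *m diag_mx (\row_j v j).
  by apply/matrixP => i j; rewrite mul_mx_diag mul_diag_mx !mxE; ring.
rewrite !det_mulmx !det_diag.
under [\prod_i (\row_i u i) 0 i]eq_bigr do rewrite mxE.
under [\prod_i (\row_j v j) 0 i]eq_bigr do rewrite mxE.
by ring.
Qed.

End PolynomialSizes.

Lemma bin2D a b : 'C(a + b, 2) = ('C(a, 2) + 'C(b, 2) + a * b)%N.
Proof.
elim: b => [|b IH]; first by rewrite muln0 !addn0.
by rewrite addnS !binS !bin1 IH mulnS; lia.
Qed.

(* The truncated subtractions of [ell] can only enlarge the right-hand side. *)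
Lemma ell_size_bound p A B a b k l n :
  ((p + (2 * (A + B + k * l + k + l)).+1).-1 <=
   ((A + B + k * l + k + l + (a + b + n)).+1 +
    ((k.+1 * l).+1 + (l.+1 * k).+1).-1).-1)%N ->
  (p <= (a - A + (b - B) + k * l + n).+1)%N.
Proof. by rewrite !mulSn (mulnC l k); lia. Qed.

(** * Laguerre and Jacobi polynomials *)

Section ClassicalPolynomials.
Variable R : realType.
Implicit Types (a b : R) (n k : nat).

Lemma risingSl a n : rising a n.+1 = a * rising (a + 1) n.
Proof.
rewrite /rising big_ord_recl addr0; congr (_ * _); apply: eq_bigr => i _.
by rewrite lift0 -addrA nat1r.
Qed.

Lemma risingSr a n : rising a n.+1 = rising a n * (a + n%:R).
Proof. by rewrite /rising big_ord_recr. Qed.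

Lemma rising_gt0 a n : 0 < a -> 0 < rising a n.
Proof. by move=> a0; apply: prodr_gt0 => i _; rewrite ltr_wpDr. Qed.

(** Coefficient form of Laguerre's equation, kept free of division because [k + a + 1] can vanish
    for the parameter [1/2 - g] of the type II seeds. *)
Lemma laguerre_coef_rec n a k :
  k.+1%:R * (k%:R + a + 1) * (laguerre_poly n a)`_k.+1
  = (k%:R - n%:R) * (laguerre_poly n a)`_k.
Proof.
rewrite !coef_poly !ltnS; case: (ltngtP k n) => [ltkn|ltnk|->].
- have [j ->] : exists j, n = (k + j.+1)%N by exists (n - k.+1)%N; rewrite addnS -addSn subnKC.
  rewrite (addKn k j.+1) addnS subSS addKn -addnS.
  rewrite risingSl !factS.
  have -> : a + k.+1%:R + 1 = a + k%:R + 1 + 1 :> R by rewrite -natr1; ring.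
  rewrite exprS !natrM -!natr1 natrD -natr1.
  have : k`!%:R != 0 :> R by rewrite pnatr_eq0 -lt0n fact_gt0.
  have : j`!%:R != 0 :> R by rewrite pnatr_eq0 -lt0n fact_gt0.
  have : k%:R + 1 != 0 :> R by rewrite natr1 pnatr_eq0.
  have : j%:R + 1 != 0 :> R by rewrite natr1 pnatr_eq0.
  by move=> *; field; do ?[apply/andP; split].
- by rewrite !mulr0.
- by rewrite subrr mul0r mulr0.
Qed.

Lemma laguerre_ode n a :
  'X * (laguerre_poly n a)^`()^`() + ((a + 1)%:P - 'X) * (laguerre_poly n a)^`()
  + n%:R *: laguerre_poly n a = 0.
Proof.
apply/polyP => k; have := laguerre_coef_rec n a k.
set p := laguerre_poly n a => h.
rewrite coef0 !coefD mulrBl coefB coefCM !coefXM coefZ.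
case: k h => [|k] /= h; rewrite !coef_deriv.
  by move: h; rewrite !(mul1r, add0r, subr0, mulr1) => ->; ring.
rewrite -[RHS](subrr ((k.+1%:R - n%:R) * p`_k.+1)) -{1}h; ring.
Qed.

Lemma laguerre_neq0 n a : 0 < a + 1 -> laguerre_poly n a != 0.
Proof.
move=> a0; apply/eqP => /(congr1 (fun p : {poly R} => p`_0)) /eqP.
rewrite coef_poly coef0 /= expr0 mul1r addr0; apply/negP; rewrite mulf_neq0 //.
by rewrite gt_eqF // rising_gt0.
Qed.

Lemma size_laguerre n a : (size (laguerre_poly n a) <= n.+1)%N.
Proof. exact: size_poly. Qed.

(** The Jacobi polynomial in the variable [(X - 1) / 2], where its coefficients obey a two-term
    recurrence. *)
Let jac n a b : {poly R} := \poly_(k < n.+1)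
  (rising (n%:R + a + b + 1) k * rising (a + k%:R + 1) (n - k)
    / (k`! * (n - k)`!)%:R).

Lemma jacobi_poly_comp n a b : jacobi_poly n a b = jac n a b \Po (2^-1 *: ('X - 1)).
Proof.
rewrite /jac poly_def (raddf_sum (comp_poly _)) /=; apply: eq_bigr => k _.
by rewrite comp_polyZ comp_Xn_poly.
Qed.

Lemma size_affine : size (2^-1 *: ('X - 1) : {poly R}) = 2%N.
Proof. by rewrite size_scale ?invr_eq0 ?pnatr_eq0 // -[1]/(1%:P) size_XsubC. Qed.

Lemma jac_coef_rec n a b k :
  k.+1%:R * (k%:R + a + 1) * (jac n a b)`_k.+1
  = (n%:R - k%:R) * (n%:R + k%:R + a + b + 1) * (jac n a b)`_k.
Proof.
rewrite !coef_poly !ltnS; case: (ltngtP k n) => [ltkn|ltnk|->].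
- have [j ->] : exists j, n = (k + j.+1)%N by exists (n - k.+1)%N; rewrite addnS -addSn subnKC.
  rewrite (addKn k j.+1) addnS subSS addKn -addnS.
  rewrite risingSr risingSl !factS.
  have -> : a + k.+1%:R + 1 = a + k%:R + 1 + 1 :> R by rewrite -natr1; ring.
  set r := rising _ k; set r' := rising _ j.
  rewrite !natrM -!natr1 natrD -natr1.
  have : k`!%:R != 0 :> R by rewrite pnatr_eq0 -lt0n fact_gt0.
  have : j`!%:R != 0 :> R by rewrite pnatr_eq0 -lt0n fact_gt0.
  have : k%:R + 1 != 0 :> R by rewrite natr1 pnatr_eq0.
  have : j%:R + 1 != 0 :> R by rewrite natr1 pnatr_eq0.
  by move=> *; field; do ?[apply/andP; split].
- by rewrite !mulr0.
- by rewrite subrr !mul0r mulr0.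
Qed.

Lemma jac_ode n a b (p := jac n a b) :
  ('X + 'X ^+ 2) * p^`()^`() + ((a + 1)%:P + (a + b + 2) *: 'X) * p^`()
  - (n%:R * (n%:R + a + b + 1)) *: p = 0.
Proof.
apply/polyP => k; have := jac_coef_rec n a b k; rewrite -/p => h.
rewrite coef0 !(coefB, coefD) coefZ !mulrDl !coefD expr2 -mulrA -scalerAl.
rewrite coefZ coefCM !coefXM.
case: k h => [|k] /= h.
  rewrite !coef_deriv; move: h.
  by rewrite !(mul1r, add0r, subr0, mulr1, addr0, mulr0) => ->; ring.
case: k h => [|k] /= h; rewrite !coef_deriv.
  rewrite -[RHS](subrr (2 * (1 + a + 1) * p`_2)) {2}h; ring.
rewrite -[RHS](subrr (k.+3%:R * (k.+2%:R + a + 1) * p`_k.+3)) {2}h.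
ring.
Qed.

Lemma jacobi_ode n a b (p := jacobi_poly n a b) :
  (1 - 'X ^+ 2) * p^`()^`() + ((b - a)%:P - (a + b + 2) *: 'X) * p^`()
  + (n%:R * (n%:R + a + b + 1)) *: p = 0.
Proof.
rewrite /p jacobi_poly_comp; set u := 2^-1 *: _.
have du : u^`() = (2^-1)%:P by rewrite derivZ derivB derivX derivC subr0 alg_polyC.
have h : ((u + u ^+ 2) * ((jac n a b)^`()^`() \Po u)
    + ((a + 1)%:P + (a + b + 2) *: u) * ((jac n a b)^`() \Po u)
    - (n%:R * (n%:R + a + b + 1)) *: (jac n a b \Po u) = 0).
  rewrite -(comp_poly0 u) -(jac_ode n a b) comp_polyB comp_polyD comp_polyZ.
  by rewrite !comp_polyM !comp_polyD comp_polyZ comp_polyX comp_polyC comp_polyM comp_polyX.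
rewrite deriv_comp du derivM deriv_comp du derivC mulr0 addr0.
move: h; set p2 := _^`()^`() \Po u; set p1 := _^`() \Po u; set p0 := jac _ _ _ \Po u.
have -> : 'X = 1 + 2%:P * u :> {poly R}.
  by rewrite /u -mul_polyC mulrA -polyCM divff ?pnatr_eq0 // mul1r; ring.
rewrite -!mul_polyC => h; rewrite -[RHS]oppr0 -[in RHS]h.
set q2 := p2 * _ * _; set q1 := p1 * _.
have ww : 2 * (2^-1)%:P = 1 :> {poly R} by rewrite -polyC1 -polyCMn -polyCM divff ?pnatr_eq0.
have -> : p2 = 4 * q2.
  transitivity (2 * (2^-1)%:P * (2 * (2^-1)%:P) * p2); first by rewrite ww !mul1r.
  by rewrite /q2; ring.
have -> : p1 = 2 * q1 by rewrite /q1 mulrCA ww mulr1.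
ring.
Qed.
Lemma size_jacobi n a b : (size (jacobi_poly n a b) <= n.+1)%N.
Proof. by rewrite jacobi_poly_comp size_comp_poly2 ?size_affine // size_poly. Qed.

Lemma jacobi_neq0 n a b : 0 < a + 1 -> jacobi_poly n a b != 0.
Proof.
move=> a0; rewrite jacobi_poly_comp comp_poly2_eq0 ?size_affine //.
apply/eqP => /(congr1 (fun p : {poly R} => p`_0)) /eqP.
rewrite coef_poly coef0 /= [rising _ 0]big_ord0 mul1r addr0; apply/negP; rewrite mulf_neq0 //.
by rewrite gt_eqF // rising_gt0.
Qed.
End ClassicalPolynomials.

(** * Derivatives on the eta-interval *)

Section DerivativeFacts.
Variable R : realType.
Implicit Types (s : system R) (f : R -> R) (x : R).

Lemma open_eta_range s : open (eta_range s).
Proof.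
case: s => [g|g h] /=; first exact: open_gt.
have -> : [set x : R | -1 < x < 1] = [set x | -1 < x] `&` [set x | x < 1].
  by apply/seteqP; split=> x /=; [move/andP|move=> [-> ->]].
by apply: openI; [exact: open_gt|exact: open_lt].
Qed.

Lemma near_eta_range s x : eta_range s x -> \forall y \near x, eta_range s y.
Proof. by move=> sx; apply: open_nbhs_nbhs; split=> //; exact: open_eta_range. Qed.

Lemma is_derive_eq_on s f1 f2 x df : eta_range s x ->
  (forall y, eta_range s y -> f1 y = f2 y) ->
  is_derive x 1 (f1 : R -> R^o) df -> is_derive x 1 (f2 : R -> R^o) df.
Proof.
move=> sx e; apply: near_eq_is_derive.
by near=> y; apply: e; near: y; exact: near_eta_range.
Unshelve. all: by end_near. Qed.

Lemma is_derive_unique x f (d1 d2 : R) :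
  is_derive x 1 (f : R -> R^o) d1 -> is_derive x 1 (f : R -> R^o) d2 -> d1 = d2.
Proof. by move=> h1 h2; rewrite -(@derive_val _ _ _ _ _ _ _ h1) (@derive_val _ _ _ _ _ _ _ h2). Qed.

Lemma is_derive_zero_on s x f d : eta_range s x ->
  (forall y, eta_range s y -> f y = 0) -> is_derive x 1 (f : R -> R^o) d -> d = 0.
Proof.
move=> sx f0 /is_derive_unique; apply.
by apply: (is_derive_eq_on sx (f1 := cst 0)) => y /f0.
Qed.

Lemma derive1n_on s f (F : nat -> R -> R) :
  (forall x, eta_range s x -> f x = F 0 x) ->
  (forall i x, eta_range s x -> is_derive x 1 (F i : R -> R^o) (F i.+1 x)) ->
  forall i x, eta_range s x -> derive1n i (f : R -> R^o) x = F i x.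
Proof.
move=> f0 dF; elim=> [|i IH] x sx; first by rewrite derive1n0 f0.
rewrite derive1nS derive1E; apply: derive_val.
have := dF i x sx; apply: (is_derive_eq_on sx) => y sy.
by rewrite IH.
Qed.

Lemma is_derive_prod_fun n (h : 'I_n -> R -> R) (dh : 'I_n -> R) x :
  (forall i, is_derive x 1 (h i : R -> R^o) (dh i)) ->
  is_derive x 1 ((fun y => \prod_(i < n) h i y) : R -> R^o)
    (\sum_(i < n) \prod_(j < n) (if j == i then dh j else h j x)).
Proof.
elim: n h dh => [|n IH] h dh H.
  rewrite big_ord0.
  have -> : (fun y => \prod_(i < 0) h i y) = cst 1.
    by apply/funext => y; rewrite big_ord0.
  exact: is_derive_cst.
have := IH _ _ (fun i => H (lift ord0 i)).
have -> : (fun y => \prod_(i < n.+1) h i y)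
    = (h ord0 * (fun y => \prod_(i < n) h (lift ord0 i) y)).
  by apply/funext => y; rewrite big_ord_recl.
move=> IH'; apply: is_derive_eq.
rewrite big_ord_recl big_ord_recl /= addrC; congr (_ + _).
  by rewrite /GRing.scale /= mulrC; congr (_ * _); apply: eq_bigr => j _.
rewrite /GRing.scale /= mulr_sumr; apply: eq_bigr => i _.
rewrite big_ord_recl /=; congr (_ * _).
Qed.

Lemma is_derive_rowdet (F : nat -> nat -> R -> R) (k : nat) rho x :
  (forall i j, (j < k)%N -> is_derive x 1 (F i j : R -> R^o) (F i.+1 j x)) ->
  is_derive x 1 ((fun y => rowdet (fun i j => F i j y) k rho) : R -> R^o)
    (\sum_(i < k) rowdet (fun i j => F i j x) k (raise 1 i rho)).
Proof.
move=> dF; rewrite /rowdet /determinant exchange_big /=.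
have -> : (fun y => \sum_(s : 'S_k) (-1) ^+ s *
   \prod_(i < k) (\matrix_(i0, j) F (rho i0) j y) i (s i))
  = \sum_(s : 'S_k) ((-1) ^+ s *: (fun y => \prod_(i < k) F (rho i) (s i) y)).
  apply/funext => y; rewrite fct_sumE; apply: eq_bigr => t _.
  by rewrite /GRing.scale /=; congr (_ * _); apply: eq_bigr => i _; rewrite mxE.
pose dh (t : 'S_k) := (-1) ^+ t * \sum_(i < k)
  \prod_(j < k) (if j == i then F (rho j).+1 (t j) x else F (rho j) (t j) x).
have -> : \sum_(t : 'S_k) \sum_(i < k) (-1) ^+ t * \prod_(i0 < k)
    (\matrix_(i1, j) F (raise 1 i rho i1) j x) i0 (t i0) = \sum_t dh t.
  apply: eq_bigr => t _; rewrite /dh mulr_sumr; apply: eq_bigr => i _.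
  congr (_ * _); apply: eq_bigr => j _; rewrite mxE -val_eqE /raise.
  by case: eqP => _; rewrite ?addn1 ?addn0.
have dP (t : 'S_k) : is_derive x 1
    ((-1) ^+ t *: (fun y => \prod_(i < k) F (rho i) (t i) y) : R -> R^o) (dh t).
  apply: is_deriveZ; apply: is_derive_prod_fun => i; exact: dF.
elim/big_ind2: _ => //; first exact: is_derive_cst.
by move=> f1 d1 f2 d2 h1 h2; exact: is_deriveD.
Qed.
End DerivativeFacts.

(** * Gauge factors and their logarithmic derivatives *)

Section Gauges.
Variable R : realType.
Implicit Types (s : system R) (f gam : R -> R) (sig : {poly R}) (x a : R).

Lemma is_derive_mul f1 f2 d1 d2 x :
  is_derive x 1 (f1 : R -> R^o) d1 -> is_derive x 1 (f2 : R -> R^o) d2 ->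
  is_derive x 1 ((fun y => f1 y * f2 y) : R -> R^o) (d1 * f2 x + f1 x * d2).
Proof.
move=> h1 h2; have h := is_deriveM h1 h2.
by apply: (is_derive_eq h); rewrite /GRing.scale /= addrC mulrC.
Qed.

Lemma is_derive_comp f1 f2 d1 d2 x :
  is_derive (f2 x) 1 (f1 : R -> R^o) d1 -> is_derive x 1 (f2 : R -> R^o) d2 ->
  is_derive x 1 ((fun y => f1 (f2 y)) : R -> R^o) (d1 * d2).
Proof. by move=> h1 h2; exact: (is_derive1_comp h1 h2). Qed.

Lemma is_derive_inv f d x : f x != 0 -> is_derive x 1 (f : R -> R^o) d ->
  is_derive x 1 ((fun y => (f y)^-1) : R -> R^o) (- d / f x ^+ 2).
Proof.
move=> fx0 h; have hd : derivable (f : R -> R^o) x 1 by case: h.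
have dv := @derive_val _ _ _ _ _ _ _ h.
apply: DeriveDef; first exact: derivableV.
by rewrite deriveV // dv /GRing.scale /= mulrC mulrN mulNr.
Qed.

Lemma c2_neq0 s x : eta_range s x -> (c2 s).[x] != 0.
Proof.
case: s => [g|g h] /=; first by rewrite hornerX => /lt0r_neq0.
move=> /andP[h1 h2]; rewrite !hornerE; apply: lt0r_neq0.
have -> : 1 - x ^+ 2 = (1 - x) * (1 + x) by ring.
by apply: mulr_gt0; lra.
Qed.

(** Every gauge that occurs (powers, exponentials, the prefactors) has a logarithmic derivative of
    the form polynomial over [c2]; differentiation of a gauge times a polynomial thus stays within
    rational functions times that gauge. *)
Definition log_derivative s gam sig := forall x, eta_range s x ->
  is_derive x 1 (gam : R -> R^o) (gam x * sig.[x] / (c2 s).[x]).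

Lemma log_derivativeM s gam1 gam2 sig1 sig2 :
  log_derivative s gam1 sig1 -> log_derivative s gam2 sig2 ->
  log_derivative s (fun x => gam1 x * gam2 x) (sig1 + sig2).
Proof.
move=> h1 h2 x sx; apply: (is_derive_eq (is_derive_mul (h1 x sx) (h2 x sx))).
by rewrite hornerD; ring.
Qed.

Lemma log_derivative1 s : log_derivative s (fun=> 1) 0.
Proof.
by move=> x sx; rewrite horner0 mulr0 mul0r; exact: is_derive_cst.
Qed.

Lemma is_derive_affine_powR (u : {poly R}) a x : 0 < u.[x] ->
  is_derive x 1 ((fun y => u.[y] `^ a) : R -> R^o)
    (u.[x] `^ a * (a * u^`().[x]) / u.[x]).
Proof.
move=> ux; apply: (is_derive_eq (is_derive_comp (is_derive1_powR a ux) (is_derive_poly u x))).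
rewrite powRB ?(gt_eqF ux) ?implybT // powRr1 ?ltW //.
by field; rewrite gt_eqF.
Qed.

Lemma log_derivative_powR g a : log_derivative (Laguerre g) (fun x => x `^ a) a%:P.
Proof.
move=> x /= x0; have ux : 0 < ('X : {poly R}).[x] by rewrite hornerX.
have -> : (fun y => y `^ a) = (fun y => ('X).[y] `^ a).
  by apply/funext => y; rewrite hornerX.
by apply: (is_derive_eq (is_derive_affine_powR a ux)); rewrite derivX !hornerE /= mulr1.
Qed.

Lemma log_derivative_expR g a :
  log_derivative (Laguerre g) (fun x => expR (a * x)) (a *: 'X).
Proof.
move=> x /= x0.
have h := is_derive_comp (is_derive_expR (a *: 'X).[x]) (is_derive_poly (a *: 'X) x).
have -> : (fun y => expR (a * y)) = (fun y => expR (a *: 'X).[y]).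
  by apply/funext => y; rewrite !hornerE.
apply: (is_derive_eq h); rewrite derivZ derivX !hornerE /=.
by field; rewrite gt_eqF.
Qed.

Lemma log_derivative_powR_plus g h a :
  log_derivative (Jacobi g h) (fun x => ((1 + x) / 2) `^ a) (a *: (1 - 'X)).
Proof.
move=> x /= /andP[x1 x2]; pose u : {poly R} := 2^-1 *: (1 + 'X).
have uE y : u.[y] = (1 + y) / 2 by rewrite !hornerE mulrC.
have ux : 0 < u.[x] by rewrite uE; lra.
have -> : (fun y => ((1 + y) / 2) `^ a) = (fun y => u.[y] `^ a).
  by apply/funext => y; rewrite uE.
apply: (is_derive_eq (is_derive_affine_powR a ux)).
rewrite uE derivZ derivD derivX derivC !hornerE /=; set p := powR _ _.
field; rewrite ?pnatr_eq0 //=; apply/andP; split; apply/eqP; nra.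
Qed.

Lemma log_derivative_powR_minus g h a :
  log_derivative (Jacobi g h) (fun x => ((1 - x) / 2) `^ a) (- a *: (1 + 'X)).
Proof.
move=> x /= /andP[x1 x2]; pose u : {poly R} := 2^-1 *: (1 - 'X).
have uE y : u.[y] = (1 - y) / 2 by rewrite !hornerE mulrC.
have ux : 0 < u.[x] by rewrite uE; lra.
have -> : (fun y => ((1 - y) / 2) `^ a) = (fun y => u.[y] `^ a).
  by apply/funext => y; rewrite uE.
apply: (is_derive_eq (is_derive_affine_powR a ux)).
rewrite uE derivZ derivB derivX derivC !hornerE /=; set p := powR _ _.
field; rewrite ?pnatr_eq0 //=; apply/andP; split; apply/eqP; nra.
Qed.
End Gauges.

(** * Quasi-polynomial eigenfunctions *)

(* Represents [gauge * amp], where [c2 * gauge' = dlog * gauge]. *)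
Record quasi (R : realType) := Quasi {
  gauge : R -> R;
  dlog : {poly R};
  amp : {poly R}
}.

Section QuasiPolynomials.
Variable R : realType.
Implicit Types (s : system R) (q : quasi R) (x lam : R) (i v : nat).

Definition quasi_fun q x := gauge q x * (amp q).[x].

(** The [i]-th derivative of gauge times amplitude is the gauge times [numer s q i] over [c2 ^ i];
    the recursion is the quotient rule with denominators cleared. *)
Fixpoint numer s q i : {poly R} :=
  if i is j.+1 then
    c2 s * (numer s q j)^`() + (dlog q - j%:R *: (c2 s)^`()) * numer s q j
  else amp q.

Definition quasi_der s q i x := gauge q x * (numer s q i).[x] / (c2 s).[x] ^+ i.

Lemma is_derive_quasi s q i x : log_derivative s (gauge q) (dlog q) ->
  eta_range s x -> is_derive x 1 (quasi_der s q i : R -> R^o) (quasi_der s q i.+1 x).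
Proof.
move=> lq sx; have c0 := c2_neq0 sx.
have ci0 : (c2 s ^+ i).[x] != 0 by rewrite horner_exp expf_neq0.
have -> : quasi_der s q i
    = fun y => gauge q y * (numer s q i).[y] * ((c2 s ^+ i).[y])^-1.
  by apply/funext => y; rewrite horner_exp.
have h := is_derive_mul
  (is_derive_mul (lq x sx) (is_derive_poly (numer s q i) x))
  (is_derive_inv ci0 (is_derive_poly (c2 s ^+ i) x)).
apply: (is_derive_eq h); rewrite /quasi_der /= deriv_exp.
rewrite hornerMn !(hornerD, hornerN, hornerM, hornerZ, horner_exp).
have Ci : (c2 s).[x] ^+ i.-1 != 0 by rewrite expf_neq0.
case: i {h ci0} Ci => [|i] /= Ci; first by rewrite !expr0 mulr0n; field.
by rewrite -mulr_natr !exprS; field; rewrite c0 Ci.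
Qed.

(** This is [c2 f'' + c1 f' = lam f] for [f = quasi_fun q], divided by the gauge and multiplied by
    [c2]: a purely polynomial identity. *)
Definition quasi_eigen s lam q :=
  numer s q 2 + c1 s * numer s q 1 = lam *: (c2 s * amp q).

(* Leibniz' rule: [c2] and [c1] have degree at most 2 and 1. *)
Lemma quasi_ode s lam q : log_derivative s (gauge q) (dlog q) ->
  quasi_eigen s lam q -> forall i x, eta_range s x ->
  (c2 s).[x] * quasi_der s q i.+2 x
  + (i%:R * (c2 s)^`().[x] + (c1 s).[x]) * quasi_der s q i.+1 x
  + ('C(i, 2)%:R * (c2 s)^`()^`().[x] + i%:R * (c1 s)^`().[x]) * quasi_der s q i x
  = lam * quasi_der s q i x.
Proof.
move=> lq eq; elim=> [|i IH] x sx.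
  have c0 := c2_neq0 sx.
  rewrite mul0r add0r bin0n mul0r mul0r addr0 mul0r addr0 /quasi_der.
  have := congr1 (horner^~ x) eq; rewrite /= !(hornerD, hornerN, hornerM, hornerZ).
  set C := (c2 s).[x] in c0 *; set G := gauge q x => e.
  have e' := congr1 (fun z => G / C * z) e; rewrite /= in e'.
  transitivity (G / C * (lam * (C * (amp q).[x]))); last by field.
  by rewrite -e'; field.
have dq j := is_derive_quasi j lq sx.
have dp p := is_derive_poly p x.
have d1 := is_derive_mul (dp (c2 s)) (dq i.+2).
have d2 := is_derive_mul (dp (i%:R *: (c2 s)^`() + c1 s)) (dq i.+1).
have d3 := is_derive_mul
  (dp ('C(i, 2)%:R *: (c2 s)^`()^`() + i%:R *: (c1 s)^`() - lam%:P)) (dq i).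
have := is_derive_zero_on sx _ (is_deriveD (is_deriveD d1 d2) d3).
rewrite /= !(derivD, derivN, derivZ, derivC, hornerD, hornerN, hornerZ, hornerC).
have -> : (c2 s)^`()^`()^`() = 0.
  apply/polyP => k; rewrite !coef_deriv coef0.
  by case: (s) => [g|g h]; rewrite /= !(coefB, coef1, coefXn, coefX) /= ?subr0 !mul0rn.
have -> : (c1 s)^`()^`() = 0.
  apply/polyP => k; rewrite !coef_deriv coef0.
  by case: (s) => [g|g h]; rewrite /= !(coefB, coefC, coefZ, coefX) /= ?mulr0 ?subr0 !mul0rn.
rewrite horner0 => /(_ _)/wrap[].
  move=> y sy; rewrite /= -[RHS](subrr (lam * quasi_der s q i y)) -{1}(IH y sy).
  by rewrite !fctE !(hornerD, hornerN, hornerZ, hornerC); ring.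
move=> h; apply/eqP; rewrite -subr_eq0; apply/eqP; rewrite -[RHS]h binS bin1 natrD; ring.
Qed.

(** Conjugation by the gauge adds [2 dlog] to the first-order coefficient and creates a term of
    order zero; the last hypothesis says that this term is the constant [lam + nu]. *)
Lemma quasi_eigenP s q lam (nu : R) (b : {poly R}) :
  c2 s * (amp q)^`()^`() + b * (amp q)^`() + nu *: amp q = 0 ->
  b = 2 *: dlog q + c1 s ->
  c2 s * (dlog q)^`() + dlog q * (dlog q - (c2 s)^`() + c1 s) = (lam + nu) *: c2 s ->
  quasi_eigen s lam q.
Proof.
move=> h1 bE h2; rewrite bE in h1; rewrite /quasi_eigen /= scale0r subr0 scale1r.
rewrite derivD !derivM.
set C := c2 s in h1 h2 *; set p := amp q in h1 *; set sg := dlog q in h1 h2 *.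
set C' := C^`() in h2 *; set p' := p^`() in h1 *; set p2 := p'^`() in h1 *.
set c := c1 s in h1 h2 *; set sg' := sg^`() in h2 *.
transitivity (C * (C * p2 + (2 *: sg + c) * p' + nu *: p)
  + (C * sg' + sg * (sg - C' + c)) * p - nu *: (C * p)).
  by rewrite -!mul_polyC; ring.
by rewrite h1 h2 -!mul_polyC polyCD; ring.
Qed.

Lemma size_numer s q i d : (size (amp q) <= d.+1)%N -> (size (dlog q) <= 2)%N ->
  (size (c2 s) <= 3)%N -> (size (numer s q i) <= d.+1 + i)%N.
Proof.
move=> sa sd sc; elim: i => [|i IH] /=; first by rewrite addn0.
have dsize (p : {poly R}) k : (size p <= k.+1)%N -> (size p^`() <= k)%N.
  move=> h; apply: leq_trans (size_poly _ _) _; by case: (size p) h.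
rewrite (leq_trans (size_polyD _ _)) // geq_max; apply/andP; split.
  apply: leq_trans (size_polyMleq _ _) _.
  have := dsize _ (d + i)%N IH.
  have -> : (d.+1 + i.+1 = (3 + (d + i)).-1)%N by rewrite addSn addnS.
  by move=> h; rewrite -!subn1 leq_sub2r // leq_add.
apply: leq_trans (size_polyMleq _ _) _.
have : (size (dlog q - i%:R *: (c2 s)^`())%R <= 2)%N.
  rewrite (leq_trans (size_polyD _ _)) // geq_max sd size_polyN.
  by rewrite (leq_trans (size_scale_leq _ _)) // dsize.
have -> : (d.+1 + i.+1 = (2 + (d.+1 + i)).-1)%N by rewrite addnS.
by move=> h; rewrite -!subn1 leq_sub2r // leq_add.
Qed.
End QuasiPolynomials.

(** * The seed functions and the classical polynomials as eigenfunctions *)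

Section Seeds.
Variable R : realType.
Implicit Types (s : system R) (v n : nat).

Definition quasiI s v : quasi R :=
  match s with
  | Laguerre g => Quasi expR 'X (laguerre_poly v (g - 1/2) \Po - 'X)
  | Jacobi g h => Quasi (fun x => ((1 + x) / 2) `^ (1/2 - h))
      ((1/2 - h) *: (1 - 'X)) (jacobi_poly v (g - 1/2) (1/2 - h))
  end.

Definition quasiII s v : quasi R :=
  match s with
  | Laguerre g => Quasi (fun x => x `^ (1/2 - g)) (1/2 - g)%:P
      (laguerre_poly v (1/2 - g))
  | Jacobi g h => Quasi (fun x => ((1 - x) / 2) `^ (1/2 - g))
      (- (1/2 - g) *: (1 + 'X)) (jacobi_poly v (1/2 - g) (h - 1/2))
  end.

Definition quasiP s n : quasi R := Quasi (fun=> 1) 0 (classical_poly s n).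

(** Normalised as in [eigenP]: the energy of the corresponding virtual state is [-4] times this
    eigenvalue. *)
Definition lamI s v : R :=
  match s with
  | Laguerre g => g + v%:R + 1/2
  | Jacobi g h => (g + v%:R + 1/2) * (h - v%:R - 1/2)
  end.

Definition lamII s v : R :=
  match s with
  | Laguerre g => g - v%:R - 1/2
  | Jacobi g h => (g - v%:R - 1/2) * (h + v%:R + 1/2)
  end.

Lemma muIE s v : muI s v = quasi_fun (quasiI s v).
Proof.
apply/funext => x; case: s => [g|g h] //.
by rewrite /quasi_fun /= horner_comp !hornerE.
Qed.

Lemma muIIE s v : muII s v = quasi_fun (quasiII s v).
Proof. by case: s. Qed.

Lemma classicalE s n : horner (classical_poly s n) = quasi_fun (quasiP s n).
Proof. by apply/funext => x; rewrite /quasi_fun mul1r. Qed.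

Lemma log_derivativeI s v : log_derivative s (gauge (quasiI s v)) (dlog (quasiI s v)).
Proof.
case: s => [g|g h] /=; last exact: log_derivative_powR_plus.
have := @log_derivative_expR _ g 1; rewrite scale1r.
by under eq_fun do rewrite mul1r.
Qed.

Lemma log_derivativeII s v : log_derivative s (gauge (quasiII s v)) (dlog (quasiII s v)).
Proof.
case: s => [g|g h] /=; [exact: log_derivative_powR|exact: log_derivative_powR_minus].
Qed.

Lemma eigenI s v : quasi_eigen s (lamI s v) (quasiI s v).
Proof.
case: s => [g|g h].
  apply: (@quasi_eigenP _ _ _ _ (- v%:R) ((g + 1/2)%:P + 'X)).
  - have h : ((- 'X) * ((laguerre_poly v (g - 1/2))^`()^`() \Po - 'X)
       + ((g - 1/2 + 1)%:P - - 'X) * ((laguerre_poly v (g - 1/2))^`() \Po - 'X)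
       + v%:R *: (laguerre_poly v (g - 1/2) \Po - 'X) = 0 :> {poly R}).
      rewrite -(comp_poly0 (- 'X)) -(laguerre_ode v (g - 1/2)).
      rewrite !comp_polyD comp_polyZ !comp_polyM comp_polyB comp_polyC comp_polyX.
      by [].
    rewrite /= deriv_comp derivM deriv_comp derivN derivX derivN derivC.
    rewrite -[RHS]oppr0 -[in RHS]h -!mul_polyC.
    have -> : g - 1/2 + 1 = g + 1/2 by field.
    rewrite polyCN; ring.
  - by rewrite /= -!mul_polyC; ring.
  - rewrite /= derivX -!mul_polyC.
    have -> : g + v%:R + 1/2 + - v%:R = g + 1/2 by ring.
    ring.
pose e := 1/2 - h; pose a := g - 1/2.
have gh1 : g + h + 1 = a - e + 2 by rewrite /a /e; field.
have gh : h - g = - e - a by rewrite /a /e; field.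
apply: (@quasi_eigenP _ _ _ _ (v%:R * (v%:R + a + e + 1))
  ((e - a)%:P - (a + e + 2) *: 'X)).
- exact: jacobi_ode.
- by rewrite /= gh1 gh -/e -!mul_polyC; ring.
rewrite /lamI.
have -> : (g + v%:R + 1/2) * (h - v%:R - 1/2) + v%:R * (v%:R + a + e + 1)
  = - e * (a + 1) by rewrite /a /e; field.
rewrite /= gh1 gh -/e derivZ !derivB derivXn derivX !derivC -!mul_polyC /= expr1.
ring.
Qed.

Lemma eigenII s v : quasi_eigen s (lamII s v) (quasiII s v).
Proof.
case: s => [g|g h].
  pose e := 1/2 - g.
  apply: (@quasi_eigenP _ _ _ _ v%:R ((e + 1)%:P - 'X)).
  - exact: laguerre_ode.
  - have -> : e + 1 = 2 * e + (g + 1/2) by rewrite /e; field.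
    by rewrite /= -/e -!mul_polyC; ring.
  - have -> : lamII (Laguerre g) v + v%:R = - e by rewrite /lamII /e; field.
    rewrite /= -/e derivX derivC -!mul_polyC.
    have -> : g + 1/2 = 1 - e by rewrite /e; field.
    ring.
pose e := 1/2 - g; pose b := h - 1/2.
have gh1 : g + h + 1 = b - e + 2 by rewrite /b /e; field.
have gh : h - g = b + e by rewrite /b /e; field.
apply: (@quasi_eigenP _ _ _ _ (v%:R * (v%:R + e + b + 1))
  ((b - e)%:P - (e + b + 2) *: 'X)).
- exact: jacobi_ode.
- by rewrite /= gh1 gh -/e -!mul_polyC; ring.
rewrite /lamII.
have -> : (g - v%:R - 1/2) * (h + v%:R + 1/2) + v%:R * (v%:R + e + b + 1)
  = - e * (b + 1) by rewrite /b /e; field.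
rewrite /= gh1 gh -/e derivZ derivD derivB derivXn derivX !derivC -!mul_polyC /= expr1.
ring.
Qed.

Lemma eigenP s n : quasi_eigen s (- (energy s n / 4)) (quasiP s n).
Proof.
case: s => [g|g h].
  apply: (@quasi_eigenP _ _ _ _ n%:R ((g - 1/2 + 1)%:P - 'X)).
  - exact: laguerre_ode.
  - have -> : g - 1/2 + 1 = g + 1/2 by field.
    by rewrite /= -!mul_polyC; ring.
  - have -> : - (energy (Laguerre g) n / 4) + n%:R = 0 by rewrite /energy; field.
    by rewrite /= derivC scale0r; ring.
apply: (@quasi_eigenP _ _ _ _ (n%:R * (n%:R + (g - 1/2) + (h - 1/2) + 1))
  ((h - 1/2 - (g - 1/2))%:P - (g - 1/2 + (h - 1/2) + 2) *: 'X)).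
- exact: jacobi_ode.
- have -> : h - 1/2 - (g - 1/2) = h - g by field.
  have -> : g - 1/2 + (h - 1/2) + 2 = g + h + 1 by field.
  by rewrite /= -!mul_polyC; ring.
rewrite /energy; have -> : - (4 * n%:R * (n%:R + g + h) / 4)
  + n%:R * (n%:R + (g - 1/2) + (h - 1/2) + 1) = 0 by field.
by rewrite /= derivC scale0r; ring.
Qed.

Lemma size_quasiI s v : (size (amp (quasiI s v)) <= v.+1)%N.
Proof.
case: s => [g|g h] /=; last exact: size_jacobi.
by rewrite size_comp_poly2 ?size_polyN ?size_polyX // size_laguerre.
Qed.

Lemma size_quasiII s v : (size (amp (quasiII s v)) <= v.+1)%N.
Proof. by case: s => [g|g h] /=; [exact: size_laguerre|exact: size_jacobi]. Qed.

Lemma size_quasiP s v : (size (amp (quasiP s v)) <= v.+1)%N.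
Proof. by case: s => [g|g h] /=; [exact: size_laguerre|exact: size_jacobi]. Qed.

Lemma size_c2 s : (size (c2 s) <= 3)%N.
Proof.
case: s => [g|g h] /=; first by rewrite size_polyX.
by rewrite (leq_trans (size_polyD _ _)) // geq_max size_polyN size_polyXn size_poly1.
Qed.

Lemma size_dlog_le2 (a b : R) : (size (a *: 'X + b%:P)%R <= 2)%N.
Proof. by rewrite -mul_polyC size_MXaddC; case: ifP => _ //; rewrite ltnS size_polyC leq_b1. Qed.

Lemma size_dlogI s v : (size (dlog (quasiI s v)) <= 2)%N.
Proof.
case: s => [g|g h] /=; first by rewrite size_polyX.
have -> : (1/2 - h) *: (1 - 'X) = (- (1/2 - h)) *: 'X + (1/2 - h)%:P.
  by rewrite -!mul_polyC; ring.
exact: size_dlog_le2.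
Qed.

Lemma size_dlogII s v : (size (dlog (quasiII s v)) <= 2)%N.
Proof.
case: s => [g|g h] /=; first by rewrite (leq_trans (size_polyC_leq1 _)).
have -> : - (1/2 - g) *: (1 + 'X) = (- (1/2 - g)) *: 'X + (- (1/2 - g))%:P.
  by rewrite -!mul_polyC; ring.
exact: size_dlog_le2.
Qed.
End Seeds.

(** * The bilinear equation *)

Section BilinearEquation.
Variable R : realType.
Implicit Types (s : system R) (x : R).

Definition quasi0 : quasi R := Quasi (fun=> 1) 0 0.

Lemma poly_eq0_on s (p : {poly R}) :
  (forall x, eta_range s x -> p.[x] = 0) -> p = 0.
Proof.
move=> h; apply/eqP/negP => /negP pn0.
(* The points 1/2, 1/3, 1/4, ... lie in the range of both cases, and [size p] of them are too many
   roots. *)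
pose rs : seq R := [seq (i.+2%:R)^-1 | i <- iota 0 (size p)].
suff : (size rs < size p)%N by rewrite size_map size_iota ltnn.
apply: max_poly_roots pn0 _ _.
  apply/allP => _ /mapP[i _ ->]; apply/rootP/h.
  have i0 : 0 < (i.+2%:R)^-1 :> R by rewrite invr_gt0.
  case: (s) => [g|g g'] //=; rewrite (lt_trans _ i0) ?ltrN10 //=.
  by rewrite invf_lt1 ?ltr1n.
rewrite map_inj_uniq ?iota_uniq // => i j /invr_inj /eqP.
by rewrite eqr_nat => /eqP[].
Qed.

Lemma wronskian_rowdet s (qs : seq (quasi R)) x :
  (forall j, (j < size qs)%N ->
     log_derivative s (gauge (nth quasi0 qs j)) (dlog (nth quasi0 qs j))) ->
  eta_range s x ->
  wronskian (map (@quasi_fun R) qs) x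
  = rowdet (fun i j => quasi_der s (nth quasi0 qs j) i x) (size qs) id.
Proof.
move=> lq sx; rewrite /wronskian /rowdet size_map; congr (\det _).
apply/matrixP => i j; rewrite !mxE (nth_map quasi0) //.
apply: (@derive1n_on _ s _ (quasi_der s (nth quasi0 qs j))) => //.
  by move=> y _; rewrite /quasi_der expr0 divr1.
by move=> k y; exact: is_derive_quasi (lq j (ltn_ord j)).
Qed.

(** Here [t] is the logarithmic derivative of [gam] and [t1] the derivative of [t]; the derivatives
    of [p] keep [gam] as a common factor, which can later be cancelled. *)
Lemma gauge_derivatives s (p sig : {poly R}) (f f1 f2 gam : R -> R) :
  (forall x, eta_range s x -> p.[x] = f x * gam x) ->
  (forall x, eta_range s x -> is_derive x 1 (f : R -> R^o) (f1 x)) ->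
  (forall x, eta_range s x -> is_derive x 1 (f1 : R -> R^o) (f2 x)) ->
  log_derivative s gam sig -> forall x, eta_range s x ->
  let c := (c2 s).[x] in let t := sig.[x] / c in
  let t1 := (sig^`().[x] * c - sig.[x] * (c2 s)^`().[x]) / c ^+ 2 in
  p^`().[x] = (f1 x + f x * t) * gam x
  /\ p^`()^`().[x] = (f2 x + 2 * f1 x * t + f x * (t ^+ 2 + t1)) * gam x.
Proof.
move=> pE df df1 dg.
have p1E x : eta_range s x ->
    p^`().[x] = f1 x * gam x + f x * (gam x * sig.[x] / (c2 s).[x]).
  move=> sx; apply: is_derive_unique (is_derive_poly p x) _.
  apply: (is_derive_eq_on sx) (is_derive_mul (df x sx) (dg x sx)).
  by move=> y sy; rewrite pE.
move=> x sx; have c0 := c2_neq0 sx; split; first by rewrite p1E //; field.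
have h := is_derive_mul (is_derive_mul (dg x sx) (is_derive_poly sig x))
  (is_derive_inv c0 (is_derive_poly (c2 s) x)).
have h' := is_deriveD (is_derive_mul (df1 x sx) (dg x sx)) (is_derive_mul (df x sx) h).
rewrite (is_derive_unique (is_derive_poly p^`() x) (is_derive_eq_on sx _ h')).
  by field.
by move=> y sy; rewrite p1E.
Qed.

Definition prefactor_dlog s (M N : nat) (e : R) : {poly R} :=
  match s with
  | Laguerre g => ((M%:R + g + e) * N%:R)%:P + - M%:R *: 'X
  | Jacobi g h => - ((M%:R + g + e) * N%:R) *: (1 + 'X)
                  + ((N%:R + h + e) * M%:R) *: (1 - 'X)
  end.

Lemma log_derivative_prefactor s M N e :
  log_derivative s (prefactor s M N e) (prefactor_dlog s M N e).
Proof.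
case: s => [g|g h] /=; apply: log_derivativeM.
- exact: log_derivative_powR.
- have := @log_derivative_expR _ g (- M%:R).
  by under eq_fun do rewrite mulNr.
- exact: log_derivative_powR_minus.
- exact: log_derivative_powR_plus.
Qed.

Lemma prefactor_neq0 s M N e x : eta_range s x -> prefactor s M N e x != 0.
Proof.
case: s => [g|g h] /= sx; apply: mulf_neq0; rewrite gt_eqF ?expR_gt0 //;
  apply: powR_gt0 => //; move/andP: sx => [*]; lra.
Qed.
End BilinearEquation.

Section MultiIndexed.
Variable R : realType.
Variables (s : system R) (dI dII : seq nat).
Let M := size dI.
Let N := size dII.

Definition seed_data : seq (quasi R) :=
  [seq quasiI s d | d <- dI] ++ [seq quasiII s d | d <- dII].

Definition seed_lam : seq R :=
  [seq lamI s d | d <- dI] ++ [seq lamII s d | d <- dII].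

Definition bordered_data n : seq (quasi R) := rcons seed_data (quasiP s n).

Definition bordered_lam n : seq R := rcons seed_lam (- (energy s n / 4)).

Lemma size_seed_data : size seed_data = (M + N)%N.
Proof. by rewrite size_cat !size_map. Qed.

Lemma size_bordered_data n : size (bordered_data n) = (M + N).+1.
Proof. by rewrite size_rcons size_seed_data. Qed.

Definition bordered_deg n : seq nat := rcons (dI ++ dII) n.

(** Degree bound, function and eigenvalue are read at the same position, so one case distinction on
    the label serves gauges, equations and degrees alike. *)
Lemma seed_data_ind (T : nat -> quasi R -> R -> Prop) n :
  {in dI, forall d, T d (quasiI s d) (lamI s d)} ->
  {in dII, forall d, T d (quasiII s d) (lamII s d)} ->
  forall j, (j < M + N)%N ->
  T (nth 0%N (bordered_deg n) j) (nth (quasi0 R) (bordered_data n) j)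
    (nth 0 (bordered_lam n) j).
Proof.
move=> hI hII j ltj; rewrite !nth_rcons !size_cat !size_map ltj !nth_cat !size_map.
rewrite -/M -/N; case: ltnP => lejM.
  by rewrite !(nth_map 0%N) //; apply/hI/mem_nth.
have ltjN : (j - M < N)%N by rewrite ltn_subLR.
by rewrite !(nth_map 0%N) //; apply/hII/mem_nth.
Qed.

Lemma nth_bordered_last n :
  [/\ nth 0%N (bordered_deg n) (M + N) = n,
      nth (quasi0 R) (bordered_data n) (M + N) = quasiP s n
    & nth 0 (bordered_lam n) (M + N) = - (energy s n / 4)].
Proof. by rewrite !nth_rcons !size_cat !size_map !ltnn !eqxx. Qed.

Lemma bordered_data_ind (T : nat -> quasi R -> R -> Prop) n :
  {in dI, forall d, T d (quasiI s d) (lamI s d)} ->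
  {in dII, forall d, T d (quasiII s d) (lamII s d)} ->
  T n (quasiP s n) (- (energy s n / 4)) ->
  forall j, (j < (M + N).+1)%N ->
  T (nth 0%N (bordered_deg n) j) (nth (quasi0 R) (bordered_data n) j)
    (nth 0 (bordered_lam n) j).
Proof.
move=> hI hII hP j; rewrite ltnS leq_eqVlt => /predU1P[->|]; last exact: seed_data_ind.
by have [-> -> ->] := nth_bordered_last n.
Qed.

Definition Fder n x i j : R := quasi_der s (nth (quasi0 R) (bordered_data n) j) i x.

Lemma log_derivative_bordered n j : (j < (M + N).+1)%N ->
  log_derivative s (gauge (nth (quasi0 R) (bordered_data n) j))
    (dlog (nth (quasi0 R) (bordered_data n) j)).
Proof.
apply: (@bordered_data_ind (fun _ q _ => log_derivative s (gauge q) (dlog q))).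
- by move=> d _; exact: log_derivativeI.
- by move=> d _; exact: log_derivativeII.
- exact: log_derivative1.
Qed.

Lemma Fder_ode n x i j : eta_range s x -> (j < (M + N).+1)%N ->
  (c2 s).[x] * Fder n x i.+2 j
  + (i%:R * (c2 s)^`().[x] + (c1 s).[x]) * Fder n x i.+1 j
  + ('C(i, 2)%:R * (c2 s)^`()^`().[x] + i%:R * (c1 s)^`().[x]) * Fder n x i j
  = nth 0 (bordered_lam n) j * Fder n x i j.
Proof.
move=> sx ltj; apply: quasi_ode sx; first exact: log_derivative_bordered.
move: ltj; apply: (@bordered_data_ind (fun _ q lam => quasi_eigen s lam q)).
- by move=> d _; exact: eigenI.
- by move=> d _; exact: eigenII.
- exact: eigenP.
Qed.

Lemma is_derive_Fder n i j x : (j < (M + N).+1)%N -> eta_range s x ->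
  is_derive x 1 ((fun y => Fder n y i j) : R -> R^o) (Fder n x i.+1 j).
Proof. by move=> ltj sx; apply: is_derive_quasi => //; exact: log_derivative_bordered. Qed.

Lemma is_derive_wronskian n k x : (k < (M + N).+1)%N -> eta_range s x ->
  is_derive x 1 ((fun y => rowdet (Fder n y) k.+1 id) : R -> R^o)
    (rowdet (Fder n x) k.+1 (raise 1 k id)).
Proof.
move=> ltk sx.
have h := @is_derive_rowdet R (fun i j y => Fder n y i j) k.+1 id x.
apply: (is_derive_eq (h _)).
  by move=> i j ltj; apply: is_derive_Fder => //; exact: leq_trans ltj ltk.
rewrite big_ord_recr /= big1 ?add0r // => i _; exact: rowdet_raise1.
Qed.

Lemma is_derive_raised_wronskian n k x : (k < (M + N).+1)%N -> eta_range s x ->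
  is_derive x 1 ((fun y => rowdet (Fder n y) k.+1 (raise 1 k id)) : R -> R^o)
    (\sum_(i < k.+1) rowdet (Fder n x) k.+1 (raise 1 i (raise 1 k id))).
Proof.
move=> ltk sx.
apply: (@is_derive_rowdet R (fun i j y => Fder n y i j) k.+1 (raise 1 k id) x).
by move=> i j ltj; apply: is_derive_Fder => //; exact: leq_trans ltj ltk.
Qed.

Lemma seedsE : seeds s dI dII = map (@quasi_fun R) seed_data.
Proof.
rewrite /seeds map_cat -!map_comp; congr (_ ++ _); apply: eq_map => d /=.
  exact: muIE.
exact: muIIE.
Qed.

(** [Xi] is expressed through the bordered table, whose first [M + N] columns are the seeds whatever
    [n] is, so that both Wronskians come from a single table [Fder n x]. *)
Lemma Xi_wronskian Xi n x : is_Xi s dI dII Xi -> eta_range s x ->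
  Xi.[x] = rowdet (Fder n x) (M + N) id * prefactor s M N (- (1/2)) x.
Proof.
move=> hXi sx; rewrite hXi // seedsE.
have nthE j : (j < M + N)%N ->
    nth (quasi0 R) seed_data j = nth (quasi0 R) (bordered_data n) j.
  by move=> ltj; rewrite nth_rcons size_seed_data ltj.
rewrite (@wronskian_rowdet _ s) ?size_seed_data // => [|j ltj]; last first.
  by rewrite nthE //; apply: log_derivative_bordered; exact: ltnW.
congr (\det _ * _); apply/matrixP => i j; rewrite !mxE /Fder nthE //.
Qed.

Lemma PD_wronskian P n x : is_PD s dI dII n P -> eta_range s x ->
  P.[x] = rowdet (Fder n x) (M + N).+1 id * prefactor s M N (1/2) x.
Proof.
move=> hP sx; rewrite hP // seedsE classicalE -map_rcons.
rewrite (@wronskian_rowdet _ s) ?size_bordered_data // => j ltj.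
exact: log_derivative_bordered.
Qed.

(** With [E] a quarter of the energy, this is [Xi] times the eigenvalue equation for [P], divided by
    [-4]: no quotient by [Xi] is left. *)
Definition bilinear_form (E : R) (Xi P : {poly R}) : {poly R} :=
  let sMN := shift_params s (M%:R - N%:R) in
  c2 s * (P^`()^`() * Xi - 2 *: (P^`() * Xi^`()) + P * Xi^`()^`())
  + c1 sMN * (P^`() * Xi) - c1 (lower_params sMN) * (P * Xi^`())
  + E *: (P * Xi).

Lemma multi_indexed_bilinear Xi P n : (0 < M + N)%N -> Xi != 0 ->
  is_Xi s dI dII Xi -> is_PD s dI dII n P ->
  bilinear_form (energy s n / 4) Xi P = 0.
Proof.
(* The extra factor [Xi] takes care of the points where [Xi], hence the seed Wronskian, may vanish
   and [rowdet_bilinear] does not apply. *)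
move=> MN0 Xi0 hXi hP; apply: (mulIf Xi0); rewrite mul0r.
apply: (@poly_eq0_on _ s) => x sx; rewrite hornerM.
have [->|Xix0] := eqVneq Xi.[x] 0; first by rewrite mulr0.
have [k ek] : exists k, (M + N = k.+1)%N by exists (M + N).-1; rewrite prednK.
have XiE y : eta_range s y -> _ := Xi_wronskian n hXi.
have PE y : eta_range s y -> _ := PD_wronskian hP.
rewrite ek in XiE PE.
have ltk : (k < (M + N).+1)%N by rewrite ek.
have ltk' : (k.+1 < (M + N).+1)%N by rewrite ek.
have [dXi ddXi] := gauge_derivatives XiE
  (fun y => @is_derive_wronskian n k y ltk)
  (fun y => @is_derive_raised_wronskian n k y ltk)
  (@log_derivative_prefactor _ s M N (- (1/2))) sx.
have [dP ddP] := gauge_derivatives PE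
  (fun y => @is_derive_wronskian n k.+1 y ltk')
  (fun y => @is_derive_raised_wronskian n k.+1 y ltk')
  (@log_derivative_prefactor _ s M N (1/2)) sx.
have X0 : rowdet (Fder n x) k.+1 id != 0.
  by move: Xix0; rewrite XiE // mulf_eq0 negb_or => /andP[].
have := @rowdet_bilinear _ (Fder n x) k (c2 s).[x] (c2 s)^`().[x]
  (c2 s)^`()^`().[x] (c1 s).[x] (c1 s)^`().[x] (nth 0 (bordered_lam n)) X0.
rewrite -ek => /(_ (fun i j => @Fder_ode n x i j sx)).
have [_ _ ->] := nth_bordered_last n; rewrite ek /=.
move: {XiE}(XiE x sx) {PE}(PE x sx) dXi ddXi dP ddP; rewrite /=.
have c0 := c2_neq0 sx.
set X := rowdet _ k.+1 id; set X1 := rowdet _ k.+1 _; set X2 := \sum_(i < k.+1) _.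
set Y := rowdet _ k.+2 id; set Y1 := rowdet _ k.+2 _; set Y2 := \sum_(i < k.+2) _.
set phi := prefactor _ _ _ _ x; set psi := prefactor _ _ _ _ x.
have MNE : M%:R + N%:R = k.+1%:R :> R by rewrite -natrD ek.
have binE : 'C(k.+1, 2)%:R = k.+1%:R * k%:R / 2 :> R.
  have : ('C(k.+1, 2) * 2 = k.+1 * k)%N by rewrite -[2%N]/(2`!) bin_ffact ffactnS ffactn1.
  by move=> /(congr1 (fun m => m%:R : R)); rewrite !natrM => <-; rewrite mulfK ?pnatr_eq0.
move=> eXi eP dXi ddXi dP ddP hb; apply/eqP; rewrite mulf_eq0 (negbTE Xix0) orbF.
apply/eqP; rewrite /bilinear_form.
rewrite !(hornerD, hornerN, hornerM, hornerZ) dXi ddXi dP ddP eXi eP.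
move: hb; rewrite binE => /eqP; rewrite -subr_eq0 => /eqP hb.
(* The form at [x] is [phi * psi] times the Wronskian identity. The two prefactors differ by [eta^N]
   in case L and by [((1 - eta)/2)^N ((1 + eta)/2)^M] in case J; combined with the multiples of
   [c2'], this difference turns [c1] into the shifted coefficient of P' and the lowered coefficient
   of Xi'. *)
rewrite -[RHS](mulr0 (phi * psi)) -[in RHS]hb.
have kE : k%:R = M%:R + N%:R - 1 :> R by rewrite MNE -natr1 addrK.
rewrite -MNE kE {MNE kE hb binE ek ltk ltk' eXi eP dXi ddXi dP ddP}.
clearbody X X1 X2 Y Y1 Y2 phi psi.
move: c0; rewrite /prefactor_dlog.
case: (s) => [g|g h] /=.
  rewrite !(derivD, derivN, derivZ, derivX, derivC) !hornerE /= => c0.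
  by field.
rewrite expr2 !(derivD, derivN, derivM, derivZ, derivX, derivC) !hornerE /= => c0.
by field.
Qed.

(** * Nonvanishing and degrees *)

(** Together with [energy_ge0] this keeps the seed eigenvalues apart from [- (energy s n / 4)], as
    [rowdet_border_eq0] requires. *)
Lemma seed_lam_gt0 n j : admissible s dI dII -> (j < M + N)%N ->
  0 < nth 0 (bordered_lam n) j.
Proof.
move=> hs ltj.
apply: (@seed_data_ind (fun _ _ lam => 0 < lam) n _ _ j ltj) => d dIn.
  case: (s) hs => [g [hg _]|g h [hg _ hh hdI]] /=.
    have := ler0n R d; have := ler0n R (size dII); lra.
  have := hdI d dIn; have := ler0n R d; have := ler0n R (size dII) => *.
  by apply: mulr_gt0; lra.
case: (s) hs => [g [hg hdII]|g h [hg hdII hh _]] /=.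
  by have := hdII d dIn; lra.
have := hdII d dIn; have := ler0n R d; have := ler0n R (size dI) => *.
by apply: mulr_gt0; lra.
Qed.

Lemma energy_ge0 n : admissible s dI dII -> 0 <= energy s n.
Proof.
case: (s) => [g|g h [hg _ hh _]] /=; first by rewrite mulr_ge0.
have := ler0n R (size dII); have := ler0n R (size dI); have := ler0n R n => *.
by rewrite !mulr_ge0 //; lra.
Qed.

Lemma classical_poly_neq0 n : admissible s dI dII -> classical_poly s n != 0.
Proof.
case: (s) => [g [hg _]|g h [hg _ hh _]] /=; have := ler0n R (size dII) => *.
  by apply: laguerre_neq0; lra.
by apply: jacobi_neq0; lra.
Qed.

Lemma multi_indexed_neq0 Xi P n : admissible s dI dII -> (0 < M + N)%N ->
  Xi != 0 -> is_Xi s dI dII Xi -> is_PD s dI dII n P -> P != 0.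
Proof.
move=> hs MN0 Xi0 hXi hP; apply/eqP => P0.
have/eqP := classical_poly_neq0 n hs; apply.
(* The pointwise conclusion that the classical polynomial vanishes is available only where [Xi] does
   not, so the product of the two is shown to vanish on the range. *)
apply: (mulIf Xi0); rewrite mul0r.
apply: (@poly_eq0_on _ s) => x sx; rewrite hornerM.
have [->|Xix0] := eqVneq Xi.[x] 0; first by rewrite mulr0.
have [k ek] : exists k, (M + N = k.+1)%N by exists (M + N).-1; rewrite prednK.
have X0 : rowdet (Fder n x) k.+1 id != 0.
  by move: Xix0; rewrite (Xi_wronskian n hXi) // mulf_eq0 negb_or ek => /andP[].
have Y0 y : eta_range s y -> rowdet (Fder n y) k.+2 id = 0.
  move=> sy; have := PD_wronskian hP sy; rewrite P0 horner0 => /esym/eqP.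
  by rewrite mulf_eq0 (negbTE (prefactor_neq0 _ _ _ sy)) orbF ek => /eqP.
have ltk : (k.+1 < (M + N).+1)%N by rewrite ek.
have Y1 := is_derive_zero_on sx Y0 (is_derive_wronskian n ltk sx).
have := @rowdet_border_eq0 _ (Fder n x) k (c2 s).[x] (c2 s)^`().[x]
  (c2 s)^`()^`().[x] (c1 s).[x] (c1 s)^`().[x] (nth 0 (bordered_lam n)) X0.
rewrite -ek => /(_ (fun i j => @Fder_ode n x i j sx)).
have [_ eq elam] := nth_bordered_last n.
rewrite elam /Fder eq -/(Fder n x) ek.
move=> /(_ _ (Y0 x sx) Y1); rewrite /quasi_der /= mul1r expr0 divr1 => -> //.
  by rewrite mul0r.
move=> j ltj; rewrite gt_eqF //; rewrite -ek in ltj.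
apply: le_lt_trans (seed_lam_gt0 n hs ltj).
by rewrite oppr_le0 divr_ge0 ?energy_ge0.
Qed.

(* The coefficient of degree [deg P + deg Xi] in the bilinear equation is
   [(n - deg P + deg Xi) * lead_coef P * lead_coef Xi]. *)
Lemma laguerre_bilinear_size g n (Xi P : {poly R}) : s = Laguerre g ->
  Xi != 0 -> P != 0 -> bilinear_form (energy s n / 4) Xi P = 0 ->
  ((size P).-1 = (size Xi).-1 + n)%N.
Proof.
move=> es Xi0 P0; rewrite /bilinear_form es /=.
set d := (size P).-1; set k := (size Xi).-1.
have sP : size P = d.+1 by rewrite /d prednK // lt0n size_poly_eq0.
have sX : size Xi = k.+1 by rewrite /k prednK // lt0n size_poly_eq0.
set al := g + (M%:R - N%:R) + 1/2; set be := g + (M%:R - N%:R) - 1 + 1/2.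
have -> : 4 * n%:R / 4 = n%:R :> R by field.
(* The top-degree parts of the terms with coefficient [X] are traded for the Euler differences, so
   every summand of [Q] has degree below [d + k], the degree of [P * Xi]. *)
move=> h; pose Q := ('X * P^`()^`()) * Xi - 2 *: (('X * P^`()) * Xi^`())
  + P * ('X * Xi^`()^`()) + al *: (P^`() * Xi) - be *: (P * Xi^`())
  - ('X * P^`() - d%:R *: P) * Xi + P * ('X * Xi^`() - k%:R *: Xi).
have eQ : (d%:R - k%:R - n%:R) *: (P * Xi) = Q.
  apply/eqP; rewrite -subr_eq0; apply/eqP; rewrite -[RHS]oppr0 -[in RHS]h /Q.
  by rewrite -!mul_polyC; ring.
have sQ : (size Q <= d + k)%N.
  have m1 := size_mul_bound (size_Xderiv2 P) (leqnn (size Xi)).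
  have m2 : (size (('X * P^`()) * Xi^`())%R <= d + k)%N.
    have -> : (d + k = (d.+1 + k).-1)%N by rewrite addSn.
    apply: size_mul_bound; last by rewrite (leq_trans (size_deriv_pred _)) // sX.
    apply: (@size_mul_bound _ _ _ 2%N d); rewrite ?size_polyX //.
    by rewrite (leq_trans (size_deriv_pred _)) // sP.
  have m3 := size_mul_bound (leqnn (size P)) (size_Xderiv2 Xi).
  have m4 := size_mul_bound (size_deriv_pred P) (leqnn (size Xi)).
  have m5 := size_mul_bound (leqnn (size P)) (size_deriv_pred Xi).
  have m6 := size_mul_bound (size_euler P) (leqnn (size Xi)).
  have m7 := size_mul_bound (leqnn (size P)) (size_euler Xi).
  move: m1 m3 m4 m5 m6 m7; rewrite sP sX /= !addnS /= => m1 m3 m4 m5 m6 m7.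
  have D (a b : {poly R}) : (size a <= d + k)%N -> (size b <= d + k)%N ->
    (size (a + b)%R <= d + k)%N.
    by move=> ha hb; rewrite (leq_trans (size_polyD _ _)) // geq_max ha.
  have Z (c : R) (a : {poly R}) : (size a <= d + k)%N -> (size (c *: a)%R <= d + k)%N.
    by move=> ha; exact: leq_trans (size_scale_leq _ _) ha.
  rewrite /Q; do !apply: (D); rewrite ?size_polyN //; exact: Z.
have := congr1 (fun p : {poly R} => p`_(d + k)) eQ.
rewrite /= [RHS]nth_default // coefZ.
have -> : (P * Xi)`_(d + k) = lead_coef P * lead_coef Xi.
  by rewrite -lead_coefM lead_coefE size_mul // sP sX addSn addnS.
move=> /eqP; rewrite !mulf_eq0 !lead_coef_eq0 (negbTE P0) (negbTE Xi0) !orbF.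
rewrite -addrA -opprD subr_eq0 -natrD eqr_nat => /eqP //.
Qed.

(** The non-integer parts of the exponents cancel: [(1/2 - g) N + (M + g + 1/2) N = (M + 1) N], and
    likewise for [h]. *)
Lemma prod_gauge g h n x : s = Jacobi g h -> eta_range s x ->
  (\prod_(j < (M + N).+1) gauge (nth (quasi0 R) (bordered_data n) j) x)
    * prefactor s M N (1/2) x
  = ((1 - x) / 2) ^+ (M.+1 * N) * ((1 + x) / 2) ^+ (N.+1 * M).
Proof.
move=> es sx; have [x1 x2] : 0 < (1 - x) / 2 /\ 0 < (1 + x) / 2.
  by move: sx; rewrite es /= => /andP[*]; split; lra.
have -> : \prod_(j < (M + N).+1) gauge (nth (quasi0 R) (bordered_data n) j) x
          = \prod_(q <- bordered_data n) gauge q x.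
  by rewrite (big_nth (quasi0 R)) size_bordered_data big_mkord.
rewrite /bordered_data -cats1 !big_cat big_seq1 !big_map /= mulr1 es /=.
rewrite !big_const_seq !count_predT !iter_mulr !mulr1 -/M -/N.
rewrite -!powR_mulrn ?powR_ge0 // ?ltW // -!powRrM.
rewrite mulrACA [X in X * _]mulrC -mulrA.
have e1 a b : ((1 - x) / 2) `^ a * ((1 - x) / 2) `^ b = ((1 - x) / 2) `^ (a + b).
  by rewrite powRD // (gt_eqF x1) implybT.
have e2 a b : ((1 + x) / 2) `^ a * ((1 + x) / 2) `^ b = ((1 + x) / 2) `^ (a + b).
  by rewrite powRD // (gt_eqF x2) implybT.
have r4 (a b c d : R) : a * (b * (c * d)) = (a * c) * (b * d) by ring.
by rewrite r4 e1 e2; congr (_ `^ _ * _ `^ _); rewrite natrM -natr1; field.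
Qed.

(** Taking the gauge out of each column and [c2 ^ -i] out of row [i] leaves a polynomial matrix with
    entries of degree at most [d j + i]. As [c2] has degree exactly 2, the powers of [c2] moved to
    the left of [key] give back the excess degree. *)
Lemma jacobi_size g h n P : s = Jacobi g h -> P != 0 ->
  is_PD s dI dII n P -> (size P <= (ell dI dII + n).+1)%N.
Proof.
move=> es P0 hP.
pose Q := \matrix_(i < (M + N).+1, j < (M + N).+1)
  numer s (nth (quasi0 R) (bordered_data n) j) i.
pose d j := nth 0%N (bordered_deg n) j.
have sQ : (size (\det Q) <= (\sum_(i < (M + N).+1) i + \sum_(j < (M + N).+1) d j).+1)%N.
  apply: size_det_bound => i j; rewrite mxE.
  have -> : ((i + d j).+1 = (d j).+1 + i)%N by rewrite addSn addnC.
  apply: (@bordered_data_ind (fun d q _ => size (numer s q i) <= d.+1 + i)%N n) (ltn_ord j).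
  - move=> v _; apply: size_numer; [exact: size_quasiI|exact: size_dlogI|exact: size_c2].
  - move=> v _; apply: size_numer; [exact: size_quasiII|exact: size_dlogII|exact: size_c2].
  - apply: size_numer; [exact: size_quasiP|by rewrite size_poly0|exact: size_c2].
have sd : (\sum_(j < (M + N).+1) d j = sumn dI + sumn dII + n)%N.
  rewrite -sumn_cat -[RHS]sumn_rcons sumnE (big_nth 0%N) size_rcons size_cat big_mkord.
  by [].
have si : (\sum_(i < (M + N).+1) i = 'C((M + N).+1, 2))%N by rewrite -bin2_sum big_mkord.
pose wm : {poly R} := 2^-1 *: (1 - 'X); pose wp : {poly R} := 2^-1 *: (1 + 'X).
have key : P * c2 s ^+ 'C((M + N).+1, 2) = \det Q * (wm ^+ (M.+1 * N) * wp ^+ (N.+1 * M)).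
  apply/eqP; rewrite -subr_eq0; apply/eqP; apply: (@poly_eq0_on _ s) => x sx.
  apply/eqP; rewrite hornerD hornerN subr_eq0; apply/eqP.
  have c0 := c2_neq0 sx.
  rewrite hornerM (PD_wronskian hP) // horner_exp.
  pose B := map_mx (horner_eval x) Q.
  have -> : rowdet (Fder n x) (M + N).+1 id
      = (\prod_(i < (M + N).+1) ((c2 s).[x] ^+ i)^-1)
        * (\prod_(j < (M + N).+1) gauge (nth (quasi0 R) (bordered_data n) j) x) * \det B.
    rewrite -det_scale_rows_cols; congr (\det _); apply/matrixP => i j.
    by rewrite !mxE /Fder /quasi_der /horner_eval; ring.
  have -> : \det B = (\det Q).[x] by rewrite /B det_map_mx.
  rewrite prodfV -expr_sum si.
  rewrite !hornerM !horner_exp.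
  have -> : wm.[x] = (1 - x) / 2 by rewrite !hornerE /= mulrC.
  have -> : wp.[x] = (1 + x) / 2 by rewrite !hornerE /= mulrC.
  rewrite -(prod_gauge n es sx). field.
  by rewrite expf_neq0.
have sc : size (c2 s) = 3%N.
  by rewrite es /= addrC size_polyDl ?size_polyN ?size_polyXn ?size_poly1 //.
have swm : (size wm <= 2)%N.
  by rewrite (leq_trans (size_scale_leq _ _)) //
    (leq_trans (size_polyD _ _)) // geq_max size_polyN size_polyX size_poly1.
have swp : (size wp <= 2)%N.
  by rewrite (leq_trans (size_scale_leq _ _)) //
    (leq_trans (size_polyD _ _)) // geq_max size_polyX size_poly1.
have sexp (w : {poly R}) m : (size w <= 2)%N -> (size (w ^+ m) <= m.+1)%N.
  move=> hw; apply: leq_trans (size_poly_exp_leq _ _) _; rewrite ltnS.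
  by rewrite -[leqRHS]mul1n leq_mul2r; apply/orP; right; case: (size w) hw.
have bound := size_mul_bound sQ
  (size_mul_bound (sexp wm (M.+1 * N)%N swm) (sexp wp (N.+1 * M)%N swp)).
have c20 : c2 s != 0 by rewrite -size_poly_eq0 sc.
have sce : size (c2 s ^+ 'C((M + N).+1, 2)) = (2 * 'C((M + N).+1, 2)).+1.
  by rewrite -[LHS]prednK ?size_exp ?sc // lt0n size_poly_eq0 expf_neq0.
move: bound; rewrite -key size_mul // ?expf_neq0 // sce si sd.
have -> : 'C((M + N).+1, 2) = ('C(M, 2) + 'C(N, 2) + M * N + M + N)%N.
  by rewrite binS bin1 bin2D !addnA.
exact: ell_size_bound.
Qed.

End MultiIndexed.

(** * The derivative of the sinusoidal coordinate *)

Section ComplexExponential.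
Variable R : realType.
Local Open Scope complex_scope.
Implicit Types (z w c : R[i]).

Lemma expCD z w : expC (z + w) = expC z * expC w.
Proof.
case: z w => a b [c d]; rewrite /expC /= expRD cosD sinD.
apply/eqP; rewrite eq_complex /=; apply/andP; split; apply/eqP; ring.
Qed.

Lemma expC0 : expC 0 = 1 :> R[i].
Proof. by rewrite /expC /= expR0 cos0 sin0 mulr1 mulr0. Qed.

(** The derivative at 0 as a first-order estimate that includes [x = 0], to be applied separately to
    the real and imaginary parts of a complex increment. *)
Lemma is_derive0_bound (f : R -> R) (l e : R) :
  is_derive (0 : R) 1 (f : R -> R^o) l -> 0 < e ->
  exists2 d : R, 0 < d & forall x, `|x| < d -> `|f x - f 0 - l * x| <= e * `|x|.
Proof.
move=> df e0; have hd : derivable (f : R -> R^o) 0 1 by case: df.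
have dv := @derive_val _ _ _ _ _ _ _ df.
have : (fun h : R => h^-1 *: (f (h *: (1:R) + 0) - f 0)) @ 0^' --> l.
  by rewrite -dv; exact: hd.
move=> /cvgrPdist_le /(_ e e0) [d /= d0 hd'].
exists d => // x xd; have [->|x0] := eqVneq x 0.
  by rewrite subrr mulr0 subr0 normr0 mulr0.
have := hd' x; rewrite /ball_ /= sub0r normrN => /(_ xd x0).
rewrite addr0 /GRing.scale /= mulr1 => h.
have -> : f x - f 0 - l * x = - (l - x^-1 * (f x - f 0)) * x by field.
by rewrite normrM normrN ler_wpM2r.
Qed.

Lemma normC_real (a : R) : `|a%:C| = `|a|%:C.
Proof. by rewrite normc_def /= expr0n addr0 sqrtr_sqr. Qed.

Lemma normC_le (a b : R) : `|a +i* b| <= (`|a| + `|b|)%:C.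
Proof.
have -> : a +i* b = a%:C + b%:C * 'i.
  by apply/eqP; rewrite eq_complex /=; apply/andP; split; apply/eqP; ring.
apply: le_trans (ler_normD _ _) _; rewrite normrM !normC_real.
have -> : `|'i : R[i]| = 1 by rewrite normc_def /= expr0n add0r expr1n sqrtr1.
by rewrite mulr1 -rmorphD.
Qed.

Lemma normC_ge_Im (a b : R) : `|b|%:C <= `|a +i* b|.
Proof.
rewrite normc_def lecR /= -sqrtr_sqr ler_wsqrtr // lerDr; exact: sqr_ge0.
Qed.

Lemma expC_bound (e : R) : 0 < e ->
  exists2 d : R, 0 < d & forall z : R[i], `|z| < d%:C ->
    `|expC z - 1 - z| <= e%:C * `|z|.
Proof.
wlog e1 : e / e <= 1.
  move=> H e0; have [e1|e1] := leP e 1; first exact: H.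
  have [d d0 hd] := H 1 (lexx 1) ltr01; exists d => // z zd.
  apply: le_trans (hd z zd) _; rewrite ler_wpM2r // lecR; exact: ltW.
(* The real part costs [t |a| + 2 t |b|] and the imaginary part [5 t |b|], in total at most
   [8 t |z|]. Since [e <= 1], the condition [|a| < t] also gives [|a| <= 1]. *)
move=> e0; pose t := e / 8; have t0 : 0 < t by rewrite divr_gt0.
have [d1 d10 h1] := is_derive0_bound (is_derive_expR 0) t0.
have [d2 d20 h2] := is_derive0_bound (is_derive_cos 0) t0.
have [d3 d30 h3] := is_derive0_bound (is_derive_sin 0) t0.
exists (Num.min (Num.min d1 d2) (Num.min d3 t)).
  by rewrite !lt_min d10 d20 d30 t0.
case=> a b zd.
have az : `|a| < Num.min (Num.min d1 d2) (Num.min d3 t).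
  by rewrite -ltcR; apply: le_lt_trans zd; exact: (normc_ge_Re (a +i* b)).
have bz : `|b| < Num.min (Num.min d1 d2) (Num.min d3 t).
  rewrite -ltcR; apply: le_lt_trans zd; exact: normC_ge_Im.
move: az bz; rewrite !lt_min => /andP[/andP[a1 a2] /andP[a3 at_]].
move=> /andP[/andP[b1 b2] /andP[b3 bt]].
have := h1 a a1; rewrite expR0 mul1r => k1.
have := h2 b b2; rewrite cos0 sin0 oppr0 mul0r subr0 => k2.
have := h3 b b3; rewrite sin0 cos0 mul1r subr0 => k3.
have A0 := normr_ge0 a; have B0 := normr_ge0 b.
have A1 : `|a| <= 1 by apply: le_trans (ltW at_) _; rewrite /t; lra.
have re : `|expR a * cos b - 1 - a| <= t * `|a| + 2 * (t * `|b|).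
  have -> : expR a * cos b - 1 - a = (expR a - 1 - a) * cos b + (1 + a) * (cos b - 1) by ring.
  apply: le_trans (ler_normD _ _) _; rewrite !normrM; apply: lerD.
    have cb : `|cos b| <= 1 by rewrite ler_norml cos_geN1 cos_le1.
    rewrite -[leRHS]mulr1; exact: ler_pM.
  apply: ler_pM => //; apply: le_trans (ler_normD _ _) _; rewrite normr1; lra.
have im : `|expR a * sin b - b| <= 5 * (t * `|b|).
  have -> : expR a * sin b - b = (expR a - 1) * sin b + (sin b - b) by ring.
  apply: le_trans (ler_normD _ _) _; rewrite normrM.
  have -> : 5 * (t * `|b|) = (2 * t) * (2 * `|b|) + t * `|b| by ring.
  apply: lerD => //; apply: ler_pM => //.
    have -> : expR a - 1 = (expR a - 1 - a) + a by ring.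
    apply: le_trans (ler_normD _ _) _; move: k1; rewrite -/t => k1.
    have : t * `|a| <= t * 1 by rewrite ler_pM2l.
    by lra.
  have -> : sin b = (sin b - b) + b by ring.
  apply: le_trans (ler_normD _ _) _.
  have : t * `|b| <= 1 * `|b| by rewrite ler_wpM2r // /t; lra.
  by lra.
have -> : expC (a +i* b) - 1 - (a +i* b)
    = (expR a * cos b - 1 - a) +i* (expR a * sin b - b).
  by apply/eqP; rewrite eq_complex /=; apply/andP; split; apply/eqP; ring.
apply: le_trans (normC_le _ _) _.
apply: (@le_trans _ _ (t * `|a| + 7 * t * `|b|)%:C); first by rewrite lecR; lra.
have -> : e%:C * `|a +i* b| = t%:C * `|a +i* b| + (7 * t)%:C * `|a +i* b|.
  by rewrite -mulrDl -rmorphD; congr (_%:C * _); rewrite /t; field.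
rewrite rmorphD !rmorphM /=; apply: lerD; apply: ler_wpM2l; rewrite -?rmorphM /=.
- by rewrite ler0c ltW.
- exact: (normc_ge_Re (a +i* b)).
- by rewrite ler0c mulr_ge0 ?ltW.
- exact: normC_ge_Im.
Qed.

Lemma is_derive_expC c z :
  is_derive (z : R[i]^o) 1 ((fun w => expC (c * w)) : R[i]^o -> R[i]^o)
    (c * expC (c * z)).
Proof.
have lim_eq : (fun h : R[i]^o => h^-1 *:
    (((fun w => expC (c * w)) : R[i]^o -> R[i]^o) (h *: (1 : R[i]^o) + z)
     - expC (c * z))) @ 0^' --> (c * expC (c * z) : R[i]^o).
  apply/cvgrPdist_le => eps eps0.
  (* The added 1, here and in [C1], keeps the divisors positive when [c = 0]. *)
  pose B := `|expC (c * z)| * `|c| + 1.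
  have B0 : 0 < B by rewrite ltr_wpDl // mulr_ge0.
  (* [eps] is a positive element of [R[i]], hence real; [expC_bound] takes its tolerance in [R]. *)
  have epsR : eps / B \is Num.real by rewrite realE ltW // divr_gt0.
  have e0 : 0 < complex.Re (eps / B).
    by rewrite -ltcR (RRe_real epsR) divr_gt0.
  have [d d0 hd] := expC_bound e0.
  pose C1 : R[i] := `|c| + 1.
  have C10 : 0 < C1 by rewrite ltr_wpDl.
  exists (d%:C / C1); first by rewrite /= divr_gt0 // ltcR.
  move=> h /=; rewrite sub0r normrN => hlt h0.
  have hn : 0 < `|h| by rewrite normr_gt0.
  have ch : `|c * h| < d%:C.
    rewrite normrM; apply: (@le_lt_trans _ _ (C1 * `|h|)).
      by rewrite ler_wpM2r // lerDl.
    by rewrite mulrC -ltr_pdivlMr.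
  have := hd _ ch; rewrite (RRe_real epsR) => k.
  rewrite /GRing.scale /= mulr1.
  rewrite (mulrDr c h z) expCD.
  have -> : c * expC (c * z) - h^-1 * (expC (c * h) * expC (c * z) - expC (c * z))
    = - (expC (c * z) * (expC (c * h) - 1 - c * h) / h) by field.
  rewrite normrN !normrM normfV ler_pdivrMr //.
  apply: (@le_trans _ _ (`|expC (c * z)| * (eps / B * `|c * h|))); first by rewrite ler_wpM2l.
  have -> : `|expC (c * z)| * (eps / B * `|c * h|)
      = `|expC (c * z)| * `|c| * (eps / B) * `|h| by rewrite normrM; ring.
  rewrite ler_wpM2r //; apply: (@le_trans _ _ (B * (eps / B))).
    by rewrite ler_wpM2r ?lerDl // divr_ge0 ?ltW.
  by rewrite mulrC divfK ?gt_eqF.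
by split; [apply/cvg_ex; exists (c * expC (c * z))|exact: cvg_lim lim_eq].
Qed.

(** In case J a zero derivative means [exp(2iz) = exp(-2iz)]. Their product is 1, so both equal 1 or
    both equal -1, and then [cos 2z] is one of the excluded values. *)
Lemma sinusoidal_dot_neq0 (s : system R) z :
  regular_point s (sinusoidal s z) -> sinusoidal_dot s z != 0.
Proof.
case: s => [g|g h] /=.
  move=> z0; rewrite /sinusoidal_dot /= exp_derive1 /= expr1.
  rewrite mulf_neq0 ?pnatr_eq0 //; apply/eqP => zz; apply: z0.
  by rewrite zz expr0n.
move=> [n1 nm1]; apply/eqP => d0.
have EE : expC (2 * 'i * z) * expC (- (2 * 'i) * z) = 1.
  by rewrite -expCD mulNr subrr expC0.
have cosE w : cosC (2 * w) = 2^-1 * (expC (2 * 'i * w) + expC (- (2 * 'i) * w)) :> R[i].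
  rewrite /cosC mulrC; congr (_ * (expC _ + expC _)); ring.
have dc : is_derive (z : R[i]^o) 1 ((fun w => cosC (2 * w)) : R[i]^o -> R[i]^o)
   (2^-1 * (2 * 'i * expC (2 * 'i * z) + - (2 * 'i) * expC (- (2 * 'i) * z))).
  have -> : (fun w => cosC (2 * w)) = (2^-1 *:
      (((fun w => expC (2 * 'i * w)) : R[i]^o -> R[i]^o)
       + ((fun w => expC (- (2 * 'i) * w)) : R[i]^o -> R[i]^o))).
    by apply/funext => w; rewrite cosE.
  exact: (is_deriveZ _ (is_deriveD (is_derive_expC (2 * 'i) z) (is_derive_expC (- (2 * 'i)) z))).
move: d0; rewrite /sinusoidal_dot derive1E.
have -> := @derive_val _ _ _ _ _ _ _ dc.
have i0 : 'i != 0 :> R[i] by rewrite eq_complex /= oner_eq0 andbF.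
set E1 := expC _ in EE *; set E2 := expC _ in EE *.
have -> : 2^-1 * (2 * 'i * E1 + - (2 * 'i) * E2) = 'i * (E1 - E2).
  by field.
move=> /eqP; rewrite mulf_eq0 (negbTE i0) subr_eq0 /= => /eqP e12.
move: EE; rewrite -e12 -expr2 => /eqP; rewrite sqrf_eq1 => /orP[] /eqP eE.
  apply: n1; rewrite cosE -/E1 -/E2 -e12 eE; by field.
apply: nm1; rewrite cosE -/E1 -/E2 -e12 eE; by field.
Qed.
End ComplexExponential.

(** * Interpolation at the zeros *)

Section Interpolation.
Variables (R : realType) (K : nat).
Local Open Scope complex_scope.
Variable eta : 'I_K -> R[i].
Hypothesis eta_inj : injective eta.

Let rs := map eta (enum 'I_K).

Let uniq_rs : uniq rs.
Proof. by rewrite map_inj_uniq // enum_uniq. Qed.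

Let size_rs : size rs = K.
Proof. by rewrite size_map size_enum_ord. Qed.

Lemma vanish_at_nodes (p : {poly R[i]}) : (size p <= K)%N ->
  (forall n, p.[eta n] = 0) -> p = 0.
Proof.
move=> sp h; apply/eqP/negP => /negP p0.
suff : (size rs < size p)%N by rewrite size_rs ltnNge sp.
apply: max_poly_roots p0 _ uniq_rs.
by apply/allP => _ /mapP[n _ ->]; apply/rootP.
Qed.

Lemma size_node_poly m : size (node_poly eta m) = K.
Proof.
rewrite /node_poly -big_filter size_prod_XsubC.
have -> : size [seq j <- index_enum 'I_K | j != m] = #|predC1 m|.
  by rewrite -sum1_size big_filter -sum1_card; apply: eq_bigl.
by rewrite cardC1 card_ord prednK // (leq_trans _ (ltn_ord m)).
Qed.

Lemma node_poly_off n m : n != m -> (node_poly eta m).[eta n] = 0.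
Proof.
move=> ne; rewrite /node_poly horner_prod (bigD1 n) //=.
by rewrite hornerXsubC subrr mul0r.
Qed.

Lemma node_poly_diag n :
  (node_poly eta n).[eta n] = \prod_(j < K | j != n) (eta n - eta j).
Proof. by rewrite /node_poly horner_prod; apply: eq_bigr => j _; rewrite hornerXsubC. Qed.

Lemma node_poly_diag_neq0 n : \prod_(j < K | j != n) (eta n - eta j) != 0.
Proof.
apply/prodf_neq0 => j ne; rewrite subr_eq0.
by apply: contra ne => /eqP/eta_inj ->.
Qed.

Lemma lagrange_interpolation (p : {poly R[i]}) : (size p <= K)%N ->
  p = \sum_l (p.[eta l] / \prod_(j < K | j != l) (eta l - eta j))
             *: node_poly eta l.
Proof.
move=> sp; apply/eqP; rewrite -subr_eq0; apply/eqP/vanish_at_nodes.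
  rewrite (leq_trans (size_polyD _ _)) // geq_max sp size_polyN.
  apply: (big_ind (fun q : {poly R[i]} => size q <= K)%N).
  - by rewrite size_poly0.
  - by move=> q r hq hr; rewrite (leq_trans (size_polyD _ _)) // geq_max hq.
  - by move=> l _; rewrite (leq_trans (size_scale_leq _ _)) // size_node_poly.
move=> n; rewrite hornerD hornerN horner_sum (bigD1 n) //=.
rewrite [X in _ - (_ + X)]big1 => [|l ln].
  by rewrite addr0 hornerZ node_poly_diag divfK ?subrr ?node_poly_diag_neq0.
by rewrite hornerZ node_poly_off ?mulr0 // eq_sym.
Qed.

(** The nodes exhaust the degree, so [p] splits into distinct linear factors, and at a node only the
    term differentiating its own factor survives. *)
Lemma deriv_at_node (p : {poly R[i]}) n : size p = K.+1 ->
  (forall m, root p (eta m)) ->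
  p^`().[eta n] = lead_coef p * \prod_(j < K | j != n) (eta n - eta j).
Proof.
move=> sp rp.
have all_rs : all (root p) rs by apply/allP => _ /mapP[m _ ->].
have := all_roots_prod_XsubC _ all_rs _.
rewrite size_rs uniq_rootsE uniq_rs => /(_ sp isT) pE.
have pE' : p = lead_coef p *: (('X - (eta n)%:P) * node_poly eta n).
  rewrite {1}pE; congr (_ *: _).
  by rewrite /rs big_map big_enum /= (bigD1 n).
rewrite {1}pE' derivZ hornerZ; congr (_ * _).
rewrite derivM hornerD !hornerM hornerXsubC subrr mul0r addr0.
by rewrite derivXsubC hornerC mul1r node_poly_diag.
Qed.

Variables (s : system R) (M N : nat) (Xi : {poly R}).

Lemma Htilde_sum (a : 'I_K -> R[i]) (q : 'I_K -> {poly R[i]}) z :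
  Htilde s M N Xi (\sum_l a l *: q l) z = \sum_l a l * Htilde s M N Xi (q l) z.
Proof.
elim/big_ind2: _ => [|u p v q' <- <-|l _]; rewrite /Htilde.
- by rewrite !linear0 !horner0 !mulr0 !addr0 mulr0.
- by rewrite !linearD !hornerD; ring.
- by rewrite !linearZ !hornerZ; ring.
Qed.
End Interpolation.

(** * The eigenvalue equation over the complex numbers and the interpolation degree *)

Section Eigenvalue.
Variable R : realType.
Local Open Scope complex_scope.

Lemma complexifyD (p q : {poly R}) : complexify (p + q) = complexify p + complexify q.
Proof. exact: rmorphD. Qed.

Lemma complexifyN (p : {poly R}) : complexify (- p) = - complexify p.
Proof. exact: rmorphN. Qed.

Lemma complexifyM (p q : {poly R}) : complexify (p * q) = complexify p * complexify q.
Proof. exact: rmorphM. Qed.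

Lemma complexifyZ c (p : {poly R}) : complexify (c *: p) = c%:C *: complexify p.
Proof. exact: map_polyZ. Qed.

Lemma complexify_deriv (p : {poly R}) : complexify p^`() = (complexify p)^`().
Proof. by rewrite /complexify deriv_map. Qed.

Lemma Htilde_eigen (s : system R) (dI dII : seq nat) (Xi P : {poly R}) n z :
  bilinear_form s dI dII (energy s n / 4) Xi P = 0 ->
  ~ root (complexify Xi) z ->
  Htilde s (size dI) (size dII) Xi (complexify P) z
  = (energy s n)%:C * (complexify P).[z].
Proof.
move=> h /negP; rewrite rootE => Xz; rewrite /Htilde.
have := congr1 (fun p => (complexify p).[z]) h.
rewrite /= /bilinear_form [complexify 0]rmorph0 horner0.
rewrite !(complexifyD, complexifyN, complexifyM, complexifyZ, complexify_deriv).
rewrite !(hornerD, hornerN, hornerM, hornerZ).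
have -> : (energy s n)%:C = 4 * (energy s n / 4)%:C.
  by rewrite -[4]/(4%:R) -(rmorph_nat (real_complex R)) -rmorphM; congr (_%:C); field.
have -> : (2 : R)%:C = 2 by rewrite rmorph_nat.
move: Xz; set X := (complexify Xi).[z]; set X1 := (complexify Xi)^`().[z].
set X2 := (complexify Xi)^`()^`().[z]; set p := (complexify P).[z].
set p1 := (complexify P)^`().[z]; set p2 := (complexify P)^`()^`().[z].
set c := (complexify (c2 s)).[z]; set d := (complexify _).[z].
set d' := (complexify _).[z]; set E := (_ / 4)%:C.
rewrite -/p2 -/X2; move: X X1 X2 p p1 p2 c d d' E => X X1 X2 p p1 p2 c d d' E X0 B0.
apply/eqP; rewrite -subr_eq0; apply/eqP.
by rewrite -[RHS](mulr0 (- 4 / X)) -[in RHS]B0; field.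
Qed.

Lemma size_multi_indexed_lt (s : system R) dI dII Xi (P : nat -> {poly R}) n0 m :
  multi_index dI dII -> admissible s dI dII -> is_Xi s dI dII Xi ->
  (forall n, is_PD s dI dII n (P n)) -> Xi != 0 ->
  size (P n0) = (ell dI dII + n0).+1 -> (m < n0)%N ->
  (size (P m) <= ell dI dII + n0)%N.
Proof.
move=> [_ _ _ _ MN0] hs hXi hP Xi0 hdeg ltm.
have P0 n : P n != 0 := multi_indexed_neq0 hs MN0 Xi0 hXi (hP n).
case es : s => [g|g h].
  have szP n := laguerre_bilinear_size es Xi0 (P0 n)
    (multi_indexed_bilinear MN0 Xi0 hXi (hP n)).
  (* The degree of [Xi] is not given; the relation at [n0], where the degree of [P] is known, fixes
     it and thereby the degree at [m]. *)
  have := szP n0; rewrite hdeg /= => e0.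
  have sm : size (P m) = ((size Xi).-1 + m).+1.
    by rewrite -szP prednK // lt0n size_poly_eq0.
  by rewrite sm e0 ltn_add2l.
apply: leq_trans (jacobi_size es (P0 m) (hP m)) _.
by rewrite ltn_add2l.
Qed.
End Eigenvalue.
Local Open Scope complex_scope.

Theorem theorem4p2 (R : realType) (s : system R) (dI dII : seq nat)
    (Xi : {poly R}) (P : nat -> {poly R}) (n0 : nat)
    (eta xs : 'I_(ell dI dII + n0) -> R[i])
    (hD : multi_index dI dII)
    (hs : admissible s dI dII)
    (hXi : is_Xi s dI dII Xi)
    (hP : forall n : nat, is_PD s dI dII n (P n))
    (hn0 : (1 <= n0)%N)
    (hdeg : size (P n0) = (ell dI dII + n0).+1%N)
    (heta : forall z : R[i], root (complexify (P n0)) z <-> exists n, z = eta n)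
    (heta_inj : injective eta)
    (heta_reg : forall n, regular_point s (eta n))
    (heta_Xi : forall n, ~ root (complexify Xi) (eta n))
    (hxs : forall n, sinusoidal s (xs n) = eta n)
    (m : nat) (hm : (m < n0)%N) :
  let M := Mmat s (size dI) (size dII) Xi n0 eta xs in
  let v := eigvec s eta xs (P m) (P n0) in
  v != 0 /\
  forall n, \sum_l M n l * v l 0
            = (energy s n0 - energy s m)%:C * v n 0.
Proof.
case: (hD) => _ _ _ _ MN0 M v.
set K := (ell dI dII + n0)%N in eta xs heta heta_inj heta_reg heta_Xi hxs M v *.
have K0 : (0 < K)%N by rewrite /K addn_gt0 hn0 orbT.
have Xi0 : Xi != 0.
  apply/eqP => Xi0; apply: (heta_Xi (Ordinal K0)).
  by rewrite Xi0 /complexify rmorph0 root0.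
have cinj : injective (@complexify R) by apply: map_poly_inj.
have Pm0 : complexify (P m) != 0.
  apply/eqP => e; have/eqP := multi_indexed_neq0 hs MN0 Xi0 hXi (hP m); apply.
  by apply: cinj; rewrite e /complexify rmorph0.
have sPm : (size (complexify (P m)) <= K)%N.
  by rewrite size_map_poly; exact: size_multi_indexed_lt hD hs hXi hP Xi0 hdeg hm.
have sPN : size (complexify (P n0)) = K.+1 by rewrite size_map_poly.
pose D l := \prod_(j < K | j != l) (eta l - eta j).
have D0 l : D l != 0 := node_poly_diag_neq0 heta_inj l.
pose lead := lead_coef (complexify (P n0)).
have lead0 : lead != 0 by rewrite lead_coef_eq0 -size_poly_eq0 sPN.
have dPN l : (complexify (P n0))^`().[eta l] = lead * D l.
  apply: deriv_at_node => // k; apply/heta; by exists k.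
have dot0 l : sinusoidal_dot s (xs l) != 0.
  by apply: sinusoidal_dot_neq0; rewrite hxs.
have vE l : v l 0 = (complexify (P m)).[eta l] / (sinusoidal_dot s (xs l) * (lead * D l)).
  by rewrite mxE dPN.
split.
  (* If the vector vanished, [P m] would have [K] distinct zeros with degree below [K]. *)
  apply: contra_neq Pm0 => v0; apply: (vanish_at_nodes heta_inj sPm) => l.
  have := vE l; rewrite v0 mxE => /esym/eqP; rewrite mulf_eq0 invr_eq0 !mulf_eq0.
  by rewrite (negbTE (dot0 l)) (negbTE lead0) (negbTE (D0 l)) !orbF => /eqP.
move=> n; rewrite vE.
have Hm : Htilde s (size dI) (size dII) Xi (complexify (P m)) (eta n)
    = (energy s m)%:C * (complexify (P m)).[eta n].
  by apply: Htilde_eigen (heta_Xi n); exact: multi_indexed_bilinear.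
pose a l := (complexify (P m)).[eta l] / D l.
have PmE : complexify (P m) = \sum_l a l *: node_poly eta l :=
  lagrange_interpolation heta_inj sPm.
have HmE : (energy s m)%:C * (complexify (P m)).[eta n]
    = \sum_l a l * Htilde s (size dI) (size dII) Xi (node_poly eta l) (eta n).
  by rewrite -Hm {1}PmE Htilde_sum.
have PmnE : (complexify (P m)).[eta n] = \sum_l a l * (node_poly eta l).[eta n].
  by rewrite {1}PmE horner_sum; apply: eq_bigr => l _; rewrite hornerZ.
(* In [M n l * v l 0] the factor [sinusoidal_dot s (xs l)] cancels, and what depends on [l] in [v]
   is the Lagrange coefficient [a l]. The factor depending on [n] leaves the sum, which by linearity
   is the operator applied to the interpolant of [P m]. *)
transitivity (- (sinusoidal_dot s (xs n) * lead * D n)^-1 *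
  (\sum_l a l * Htilde s (size dI) (size dII) Xi (node_poly eta l) (eta n)
   - (energy s n0)%:C * \sum_l a l * (node_poly eta l).[eta n])).
  rewrite mulr_sumr -sumrB mulr_sumr; apply: eq_bigr => l _.
  rewrite vE !mxE -/(D n) /a.
  move: (dot0 l) (dot0 n) (D0 l) (D0 n) lead0.
  move: (sinusoidal_dot s (xs l)) (sinusoidal_dot s (xs n)) (D l) (D n) (lead).
  move: (Htilde _ _ _ _ _ _) (_.[eta n]) (_.[eta l]) (energy s n0)%:C.
  move=> H q p E dl dn Dl Dn c dl0 dn0 Dl0 Dn0 c0.
  by field; rewrite dl0 dn0 Dl0 Dn0 c0.
rewrite -HmE -PmnE rmorphB /=; field.
by rewrite D0 lead0 dot0.
Qed.
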